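(* Let $F$ be a field of characteristic $2$, and let $\phi=a_1[1,b_1]\perp\cdots\perp a_n[1,b_n]\perp\langle 1,c_1,\dots,c_s\rangle$ be a singular quadratic form over $F$ such that $n\ge1$ and $s\ge1$, where $a_i\in F^*$ and $b_i,c_j\in F$. Let $K=F(\sqrt{c_1},\dots,\sqrt{c_s})$. Then $C_0(\phi)$ is isomorphic to the $F$-algebra $[b_1,a_1)\otimes_F\cdots\otimes_F[b_n,a_n)\otimes_F K$. In particular, $C_0(\phi)$ has degree $2^n$ as a $K$-algebra.
   Context: $[a,b]$ denotes the binary quadratic form $ax^2+xy+by^2$, and $a_i[1,b_i]$ is the form $[1,b_i]$ scaled by $a_i$; $\langle c_1,\dots,c_s\rangle$ is the form $\sum c_iz_i^2$; $\perp$ is the orthogonal sum. A quadratic form is singular if it is isometric to $[a_1,b_1]\perp\cdots\perp[a_r,b_r]\perp\langle c_1,\dots,c_s\rangle$ with $s>0$. $C_0(\phi)$ is the even Clifford algebra of $\phi$. $F(\sqrt{c_1},\dots,\sqrt{c_s})$ is the field extension of $F$ generated by square roots of $c_1,\dots,c_s$. For $a\in F^*$ and $b\in F$, $[b,a)$ denotes the quaternion $F$-algebra generated by two elements $i,j$ subject to $i^2=a$, $j^2+j=b$, $iji^{-1}=j+1$.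
   Formalization: The formal statement adds the hypothesis [K:F] = 2^s; without it the claim fails by dimension (e.g. all c_j = 0, so K = F: 2^(2n+s) versus 4^n), and the isomorphism itself forces this equality, so no true case is lost. *)

(* Defs.v *)
From HB Require Import structures.
From mathcomp Require Import all_boot all_algebra all_field boolp ring.

Set Implicit Arguments.
Unset Strict Implicit.
Unset Printing Implicit Defensive.

Import GRing.Theory.
Local Open Scope ring_scope.
Local Open Scope quotient_scope.

Section QuadraticForms.
Variable F : fieldType.

Definition polar (V : lmodType F) (q : V -> F) (u v : V) : F :=
  q (u + v) - q u - q v.

(* The polar form is symmetric, so left linearity is bilinearity. *)
Record quadform (V : lmodType F) := QuadForm {
  qf_fun :> V -> F;
  qfZ : forall a v, qf_fun (a *: v) = a ^+ 2 * qf_fun v;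
  qf_polar : forall w, scalar (fun u => polar qf_fun u w)
}.

Lemma qf0 (V : lmodType F) (q : quadform V) : q 0 = 0.
Proof. by have := qfZ q 0 0; rewrite scale0r expr0n mul0r. Qed.

(* [a, b] = a x^2 + x y + b y^2 *)
Section Binary.
Variables a b : F.
Definition binary_fun (v : 'rV[F]_2) : F :=
  let x := v 0 0 in let y := v 0 1 in a * x ^+ 2 + x * y + b * y ^+ 2.
Fact binary_funZ c v : binary_fun (c *: v) = c ^+ 2 * binary_fun v.
Proof. by rewrite /binary_fun !mxE; ring. Qed.
Fact binary_polar w : scalar (fun u => polar binary_fun u w).
Proof. by move=> c u v; rewrite /polar /binary_fun !mxE; ring. Qed.
Definition binary : quadform 'rV[F]_2 := QuadForm binary_funZ binary_polar.
End Binary.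

Section Scaling.
Variables (V : lmodType F) (a : F) (q : quadform V).
Definition qscale_fun (v : V) : F := a * q v.
Fact qscale_funZ c v : qscale_fun (c *: v) = c ^+ 2 * qscale_fun v.
Proof. by rewrite /qscale_fun qfZ mulrCA. Qed.
Fact qscale_polar w : scalar (fun u => polar qscale_fun u w).
Proof.
have scE u : polar qscale_fun u w = a * polar q u w.
  by rewrite /polar /qscale_fun; ring.
by move=> c u v; rewrite !scE qf_polar; ring.
Qed.
Definition qscale : quadform V := QuadForm qscale_funZ qscale_polar.
End Scaling.

(* <d_1, ..., d_m> *)
Section Diagonal.
Variables (m : nat) (d : 'rV[F]_m).
Definition diag_fun (z : 'rV[F]_m) : F := \sum_j d 0 j * z 0 j ^+ 2.
Fact diag_funZ c z : diag_fun (c *: z) = c ^+ 2 * diag_fun z.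
Proof.
by rewrite /diag_fun mulr_sumr; apply: eq_bigr => j _; rewrite !mxE; ring.
Qed.
Fact diag_polar w : scalar (fun u => polar diag_fun u w).
Proof.
move=> c u v; rewrite /polar /diag_fun -!sumrB mulr_sumr -big_split.
by apply: eq_bigr => j _; rewrite !mxE /=; ring.
Qed.
Definition diag_form : quadform 'rV[F]_m := QuadForm diag_funZ diag_polar.
End Diagonal.

Section Orthogonal.
Variables (V W : lmodType F) (p : quadform V) (q : quadform W).
Definition orth_fun (x : V * W) : F := p x.1 + q x.2.
Fact orth_funZ c x : orth_fun (c *: x) = c ^+ 2 * orth_fun x.
Proof. by rewrite /orth_fun !qfZ mulrDr. Qed.
Fact orth_polar w : scalar (fun u => polar orth_fun u w).
Proof.
have orthE u : polar orth_fun u w = polar p u.1 w.1 + polar q u.2 w.2.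
  by rewrite /polar /orth_fun /=; ring.
move=> c u v; rewrite !orthE /= !qf_polar; ring.
Qed.
Definition orth : quadform (V * W)%type := QuadForm orth_funZ orth_polar.
End Orthogonal.

Section OrthogonalFamily.
Variables (I : finType) (V : lmodType F) (q : I -> quadform V).
Definition orth_sum_fun (x : {ffun I -> V}) : F := \sum_i q i (x i).
Fact orth_sum_funZ c x : orth_sum_fun (c *: x) = c ^+ 2 * orth_sum_fun x.
Proof.
by rewrite /orth_sum_fun mulr_sumr; apply: eq_bigr => i _; rewrite ffunE qfZ.
Qed.
Fact orth_sum_polar w : scalar (fun u => polar orth_sum_fun u w).
Proof.
have orthE u : polar orth_sum_fun u w = \sum_i polar (q i) (u i) (w i).
  rewrite /polar /orth_sum_fun -!sumrB; apply: eq_bigr => i _.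
  by rewrite ffunE.
move=> c u v; rewrite !orthE mulr_sumr -big_split; apply: eq_bigr => i _.
by rewrite !ffunE qf_polar.
Qed.
Definition orth_sum : quadform {ffun I -> V} :=
  QuadForm orth_sum_funZ orth_sum_polar.
End OrthogonalFamily.

End QuadraticForms.

Section Clifford.
Variables (F : fieldType) (V : vectType F) (q : quadform V).

(* The Clifford algebra is the F-algebra presented by generators [v], v in V,
   linear in v, and relations [v]^2 = q v: noncommutative polynomial
   expressions in the [v] modulo the congruence generated by these relations
   and the F-algebra axioms. *)
Inductive cl_term :=
  | ClConst of F
  | ClGen of V
  | ClAdd of cl_term & cl_term
  | ClMul of cl_term & cl_term.

HB.instance Definition _ := gen_eqMixin cl_term.
HB.instance Definition _ := gen_choiceMixin cl_term.

Inductive cl_rel : cl_term -> cl_term -> Prop :=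
  | cl_refl x : cl_rel x x
  | cl_sym x y : cl_rel x y -> cl_rel y x
  | cl_trans y x z : cl_rel x y -> cl_rel y z -> cl_rel x z
  | cl_congD x x' y y' :
      cl_rel x x' -> cl_rel y y' -> cl_rel (ClAdd x y) (ClAdd x' y')
  | cl_congM x x' y y' :
      cl_rel x x' -> cl_rel y y' -> cl_rel (ClMul x y) (ClMul x' y')
  | cl_addA x y z : cl_rel (ClAdd x (ClAdd y z)) (ClAdd (ClAdd x y) z)
  | cl_addC x y : cl_rel (ClAdd x y) (ClAdd y x)
  | cl_add0 x : cl_rel (ClAdd (ClConst 0) x) x
  | cl_addN x : cl_rel (ClAdd (ClMul (ClConst (-1)) x) x) (ClConst 0)
  | cl_mulA x y z : cl_rel (ClMul x (ClMul y z)) (ClMul (ClMul x y) z)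
  | cl_mul1 x : cl_rel (ClMul (ClConst 1) x) x
  | cl_mulDl x y z :
      cl_rel (ClMul (ClAdd x y) z) (ClAdd (ClMul x z) (ClMul y z))
  | cl_mulDr x y z :
      cl_rel (ClMul x (ClAdd y z)) (ClAdd (ClMul x y) (ClMul x z))
  | cl_constD a b : cl_rel (ClConst (a + b)) (ClAdd (ClConst a) (ClConst b))
  | cl_constM a b : cl_rel (ClConst (a * b)) (ClMul (ClConst a) (ClConst b))
  | cl_constC a x : cl_rel (ClMul (ClConst a) x) (ClMul x (ClConst a))
  | cl_genL a u v :
      cl_rel (ClGen (a *: u + v)) (ClAdd (ClMul (ClConst a) (ClGen u)) (ClGen v))
  | cl_gen2 v : cl_rel (ClMul (ClGen v) (ClGen v)) (ClConst (q v)).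

Definition cl_eq : rel cl_term := fun x y => `[< cl_rel x y >].
Fact cl_eq_refl : reflexive cl_eq.
Proof. by move=> x; apply/asboolP/cl_refl. Qed.
Fact cl_eq_sym : symmetric cl_eq.
Proof. by move=> x y; apply/asboolP/asboolP => /cl_sym. Qed.
Fact cl_eq_trans : transitive cl_eq.
Proof.
by move=> y x z /asboolP xy /asboolP yz; apply/asboolP; apply: cl_trans xy yz.
Qed.
Canonical cl_equiv := EquivRel cl_eq cl_eq_refl cl_eq_sym cl_eq_trans.

Definition clifford := {eq_quot cl_equiv}.
HB.instance Definition _ := Choice.on clifford.
HB.instance Definition _ := EqQuotient.on clifford.

Definition cl_pi (x : cl_term) : clifford := \pi_clifford x.

Lemma cl_piP x y : (cl_pi x = cl_pi y) <-> cl_rel x y.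
Proof.
split; first by move/eqmodP => /= /asboolP.
by move=> xy; apply/eqmodP/asboolP.
Qed.

Lemma cl_piW (P : clifford -> Prop) : (forall x, P (cl_pi x)) -> forall x, P x.
Proof. by move=> Ppi x; rewrite -[x]reprK; apply: Ppi. Qed.

Lemma cl_repr x : cl_rel (repr (cl_pi x)) x.
Proof. by apply/cl_piP; rewrite /cl_pi reprK. Qed.

Definition cl_add (x y : clifford) := cl_pi (ClAdd (repr x) (repr y)).
Definition cl_mul (x y : clifford) := cl_pi (ClMul (repr x) (repr y)).
Definition cl_const a := cl_pi (ClConst a).

Lemma cl_piD x y : cl_add (cl_pi x) (cl_pi y) = cl_pi (ClAdd x y).
Proof. by apply/cl_piP/cl_congD; apply: cl_repr. Qed.
Lemma cl_piM x y : cl_mul (cl_pi x) (cl_pi y) = cl_pi (ClMul x y).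
Proof. by apply/cl_piP/cl_congM; apply: cl_repr. Qed.

Fact cl_addrA : associative cl_add.
Proof.
elim/cl_piW=> x; elim/cl_piW=> y; elim/cl_piW=> z.
by rewrite !cl_piD; apply/cl_piP/cl_addA.
Qed.
Fact cl_addrC : commutative cl_add.
Proof.
by elim/cl_piW=> x; elim/cl_piW=> y; rewrite !cl_piD; apply/cl_piP/cl_addC.
Qed.
Fact cl_add0r : left_id (cl_const 0) cl_add.
Proof. by elim/cl_piW=> x; rewrite cl_piD; apply/cl_piP/cl_add0. Qed.
Fact cl_addNr : left_inverse (cl_const 0) (cl_mul (cl_const (-1))) cl_add.
Proof. by elim/cl_piW=> x; rewrite cl_piM cl_piD; apply/cl_piP/cl_addN. Qed.
HB.instance Definition _ :=
  GRing.isZmodule.Build clifford cl_addrA cl_addrC cl_add0r cl_addNr.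

Fact cl_mulrA : associative cl_mul.
Proof.
elim/cl_piW=> x; elim/cl_piW=> y; elim/cl_piW=> z.
by rewrite !cl_piM; apply/cl_piP/cl_mulA.
Qed.
Fact cl_mul1r : left_id (cl_const 1) cl_mul.
Proof. by elim/cl_piW=> x; rewrite cl_piM; apply/cl_piP/cl_mul1. Qed.
Fact cl_mulr1 : right_id (cl_const 1) cl_mul.
Proof.
elim/cl_piW=> x; rewrite cl_piM; apply/cl_piP.
by apply: cl_trans (cl_mul1 x); apply/cl_sym/cl_constC.
Qed.
Fact cl_mulrDl : left_distributive cl_mul cl_add.
Proof.
elim/cl_piW=> x; elim/cl_piW=> y; elim/cl_piW=> z.
by rewrite !(cl_piM, cl_piD); apply/cl_piP/cl_mulDl.
Qed.
Fact cl_mulrDr : right_distributive cl_mul cl_add.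
Proof.
elim/cl_piW=> x; elim/cl_piW=> y; elim/cl_piW=> z.
by rewrite !(cl_piM, cl_piD); apply/cl_piP/cl_mulDr.
Qed.

End Clifford.

(* Every quadratic form is represented by matrices squaring to its values, so
   that the Clifford algebra is not the zero ring. *)
Section Nontrivial.
Variable F : fieldType.

Section Eval.
Variables (V : vectType F) (q : quadform V) (A : algType F).
Variable f : {linear V -> A}.
Hypothesis f2 : forall v, f v * f v = (q v)%:A.

Fixpoint cl_eval (x : cl_term V) : A :=
  match x with
  | ClConst a => a%:A
  | ClGen v => f v
  | ClAdd x y => cl_eval x + cl_eval y
  | ClMul x y => cl_eval x * cl_eval y
  end.

Lemma cl_eval_rel x y : cl_rel q x y -> cl_eval x = cl_eval y.
Proof.
elim=> //=.
- by move=> {}y {}x z _ -> _ ->.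
- by move=> ? ? ? ? _ -> _ ->.
- by move=> ? ? ? ? _ -> _ ->.
- by move=> *; rewrite addrA.
- by move=> *; rewrite addrC.
- by move=> *; rewrite scale0r add0r.
- by move=> *; rewrite scale0r scaleN1r mulN1r addNr.
- by move=> *; rewrite mulrA.
- by move=> *; rewrite scale1r mul1r.
- by move=> *; rewrite mulrDl.
- by move=> *; rewrite mulrDr.
- by move=> *; rewrite scalerDl.
- by move=> *; rewrite -scalerAl mul1r scalerA.
- by move=> *; rewrite -scalerAl -scalerAr mul1r mulr1.
- by move=> *; rewrite linearP -scalerAl mul1r.
Qed.
End Eval.

Lemma clifford_rep_rV n (q : quadform 'rV[F]_n) :
  exists m, exists f : {linear 'rV[F]_n -> 'M[F]_m.+1},
    forall v, f v * f v = (q v)%:M.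
Proof.
elim: n q => [|n IHn]; last rewrite -[n.+1]/(1 + n)%N; move=> q.
  exists 0%N, \0 => v /=; rewrite mulr0.
  by rewrite (thinmx0 v) qf0 raddf0.
pose inr_ (w : 'rV[F]_n) : 'rV[F]_(1 + n) := row_mx 0 w.
have inr_lin : linear inr_.
  by move=> a u v; rewrite /inr_ scale_row_mx add_row_mx scaler0 addr0.
have inrZ : scalable inr_ by move=> a v; rewrite /inr_ scale_row_mx scaler0.
pose q'fun w := q (inr_ w).
have q'Z a v : q'fun (a *: v) = a ^+ 2 * q'fun v.
  by rewrite /q'fun -qfZ; congr (q _); exact: inrZ.
have inrD u v : inr_ (u + v) = inr_ u + inr_ v.
  by have := inr_lin 1 u v; rewrite !scale1r.
have q'P w : scalar (fun u => polar q'fun u w).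
  move=> a u v; have := qf_polar q (inr_ w) a (inr_ u) (inr_ v).
  by rewrite /polar /q'fun -inr_lin -!inrD.
have [m [f f2]] := IHn (QuadForm q'Z q'P).
pose e0 : 'rV[F]_(1 + n) := row_mx 1%:M 0.
pose b (w : 'rV[F]_n) := polar q (inr_ w) e0.
pose g (v : 'rV[F]_(1 + n)) : 'M[F]_(m.+1 + m.+1) :=
  let t := lsubmx v 0 0 in let w := rsubmx v in
  block_mx (f w) (b w + t * q e0)%:M t%:M (- f w).
have g_lin : linear g.
  move=> a u v; rewrite /g !linearP /= !mxE /b inr_lin qf_polar.
  rewrite scale_block_mx add_block_mx.
  rewrite !scale_scalar_mx -!raddfD /=; congr block_mx.
  by congr (_ %:M); ring.
have gg v : g v *m g v = (q v)%:M.
  rewrite /g; set t := lsubmx v 0 0; set w := rsubmx v.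
  have -> : v = inr_ w + t *: e0.
    rewrite /inr_ /e0 scale_row_mx add_row_mx add0r scaler0 addr0.
    by rewrite scale_scalar_mx mulr1 /t -mx11_scalar hsubmxK.
  have -> : q (inr_ w + t *: e0) = q (inr_ w) + t * (b w + t * q e0).
    have polC u u' : polar q u u' = polar q u' u.
      by rewrite /polar (addrC u') addrAC.
    have : polar q (inr_ w) (t *: e0) = t * b w.
      have := qf_polar q (inr_ w) t e0 0.
      have -> : polar q 0 (inr_ w) = 0 by rewrite /polar add0r qf0 subr0 subrr.
      by rewrite polC !addr0 /b (polC _ e0).
    by rewrite /polar qfZ => /eqP; rewrite !subr_eq => /eqP ->; ring.
  rewrite mulmx_block !mulmxN !mulNmx !opprK.
  have ff : f w *m f w = (q (inr_ w))%:M by rewrite mulmxE f2.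
  rewrite ff -!scalar_mxM -!raddfD /= !mul_scalar_mx !mul_mx_scalar.
  by rewrite !subrr scalar_mx_block; congr block_mx; congr (_ %:M); ring.
pose gL := GRing.isLinear.Build F _ _ _ g g_lin.
pose G : {linear 'rV[F]_(1 + n) -> 'M[F]_((m + m.+1).+1)} := HB.pack g gL.
by exists (m + m.+1)%N, G => v; rewrite /= -mulmxE; exact: gg.
Qed.

End Nontrivial.

Section CliffordAlgebra.
Variables (F : fieldType) (V : vectType F) (q : quadform V).

Import VectorInternalTheory.
Lemma clifford_rep : exists m, exists f : {linear V -> 'M[F]_m.+1},
  forall v, f v * f v = (q v)%:A.
Proof.
have qZ a v : q (r2v (a *: v)) = a ^+ 2 * q (r2v v) by rewrite linearZ qfZ.
have qP w : scalar (fun u => polar (fun x : 'rV_(dim V) => q (r2v x)) u w).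
  move=> a u v; have := qf_polar q (r2v w) a (r2v u) (r2v v).
  by rewrite /polar !linearD !linearZ.
have [m [f f2]] := clifford_rep_rV (QuadForm qZ qP).
by exists m, (f \o v2r) => v /=; rewrite f2 /= v2rK scalemx1.
Qed.

Fact cl_1_neq0 : cl_const q 1 != 0.
Proof.
have [m [f f2]] := clifford_rep.
apply/eqP => /cl_piP /(cl_eval_rel f2) /eqP /=.
by rewrite scale1r scale0r oner_eq0.
Qed.

HB.instance Definition _ := GRing.Zmodule_isNzRing.Build (clifford q)
  (@cl_mulrA _ _ q) (@cl_mul1r _ _ q) (@cl_mulr1 _ _ q)
  (@cl_mulrDl _ _ q) (@cl_mulrDr _ _ q) cl_1_neq0.

Lemma cl_constD_eq a b : cl_const q (a + b) = cl_const q a + cl_const q b.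
Proof. by rewrite [RHS]cl_piD; apply/cl_piP/cl_constD. Qed.
Lemma cl_constM_eq a b : cl_const q (a * b) = cl_const q a * cl_const q b.
Proof. by rewrite [RHS]cl_piM; apply/cl_piP/cl_constM. Qed.
Lemma cl_constC_eq a (x : clifford q) : cl_const q a * x = x * cl_const q a.
Proof.
by elim/cl_piW: x => x; rewrite [LHS]cl_piM [RHS]cl_piM; apply/cl_piP/cl_constC.
Qed.

Definition cl_scale a (x : clifford q) : clifford q := cl_const q a * x.

Fact cl_scalerA a b x : cl_scale a (cl_scale b x) = cl_scale (a * b) x.
Proof. by rewrite /cl_scale cl_constM_eq mulrA. Qed.
Fact cl_scale1r : left_id 1 cl_scale.
Proof. exact: mul1r. Qed.
Fact cl_scalerDr : right_distributive cl_scale +%R.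
Proof. by move=> a x y; apply: mulrDr. Qed.
Fact cl_scalerDl x : {morph cl_scale^~ x : a b / a + b}.
Proof. by move=> a b; rewrite /cl_scale cl_constD_eq mulrDl. Qed.
HB.instance Definition _ := GRing.Zmodule_isLmodule.Build F (clifford q)
  cl_scalerA cl_scale1r cl_scalerDr cl_scalerDl.

Fact cl_scalerAl a (x y : clifford q) : a *: (x * y) = (a *: x) * y.
Proof. exact: mulrA. Qed.
HB.instance Definition _ :=
  GRing.Lmodule_isLalgebra.Build F (clifford q) cl_scalerAl.

Fact cl_scalerAr a (x y : clifford q) : a *: (x * y) = x * (a *: y).
Proof. by rewrite /GRing.scale /= /cl_scale mulrA cl_constC_eq mulrA. Qed.
HB.instance Definition _ :=
  GRing.Lalgebra_isAlgebra.Build F (clifford q) cl_scalerAr.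

Definition cl_vec (v : V) : clifford q := cl_pi q (ClGen v).

Fact cl_vec_linear : linear cl_vec.
Proof.
move=> a u v; rewrite [a *: cl_vec u]cl_piM [RHS]cl_piD.
exact/cl_piP/cl_genL.
Qed.
HB.instance Definition _ :=
  GRing.isLinear.Build F V (clifford q) _ cl_vec cl_vec_linear.

Lemma cl_vec2 v : cl_vec v * cl_vec v = (q v)%:A.
Proof. by rewrite [LHS]cl_piM [RHS]mulr1; apply/cl_piP/cl_gen2. Qed.

Section Lift.
Variables (A : algType F) (f : {linear V -> A}).
Hypothesis f2 : forall v, f v * f v = (q v)%:A.

Definition cl_lift (x : clifford q) : A := cl_eval f (repr x).

Lemma cl_liftE x : cl_lift (cl_pi q x) = cl_eval f x.
Proof. exact/(cl_eval_rel f2)/cl_repr. Qed.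

Fact cl_lift_linear : linear cl_lift.
Proof.
move=> a; elim/cl_piW=> x; elim/cl_piW=> y.
have -> : a *: cl_pi q x + cl_pi q y =
    cl_pi q (ClAdd (ClMul (ClConst V a) x) y).
  by rewrite [a *: cl_pi q x]cl_piM [LHS]cl_piD.
by rewrite !cl_liftE /= -scalerAl mul1r.
Qed.
Fact cl_lift_monoid : monoid_morphism cl_lift.
Proof.
split; first by rewrite [LHS]cl_liftE /= scale1r.
elim/cl_piW=> x; elim/cl_piW=> y.
have -> : cl_pi q x * cl_pi q y = cl_pi q (ClMul x y) by rewrite [LHS]cl_piM.
by rewrite !cl_liftE.
Qed.

Lemma clifford_lift : exists g : {lrmorphism clifford q -> A},
  forall v, g (cl_vec v) = f v.
Proof.
pose gL := GRing.isLinear.Build F _ _ _ cl_lift cl_lift_linear.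
pose gM := GRing.isMonoidMorphism.Build _ _ cl_lift cl_lift_monoid.
pose g : {lrmorphism clifford q -> A} := HB.pack cl_lift gL gM.
by exists g => v; apply: cl_liftE.
Qed.
End Lift.

Lemma clifford_lift_unique (A : algType F) (g h : {lrmorphism clifford q -> A}) :
  (forall v, g (cl_vec v) = h (cl_vec v)) -> g =1 h.
Proof.
move=> gh; elim/cl_piW; elim=> [a|v|x IHx y IHy|x IHx y IHy].
- have -> : cl_pi q (ClConst V a) = a%:A by rewrite [RHS]mulr1.
  by rewrite !rmorph_alg.
- exact: gh.
- by rewrite -cl_piD !raddfD /= IHx IHy.
- by rewrite -cl_piM !rmorphM /= IHx IHy.
Qed.

(* C_0(q) is the image of the even part of the tensor algebra of V, that is,
   the span of the products of an even number of vectors. *)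
Definition even_clifford_pred : {pred clifford q} := fun x =>
  `[< exists l : seq (F * seq (V * V)),
        x = \sum_(t <- l) t.1 *: \prod_(p <- t.2) (cl_vec p.1 * cl_vec p.2) >].

Fact even_clifford_subalg : GRing.subsemialg_closed even_clifford_pred.
Proof.
split.
- by apply/asboolP; exists [:: (1, [::])]; rewrite big_seq1 /= big_nil scale1r.
- split; first by apply/asboolP; exists [::]; rewrite big_nil.
  move=> x y /asboolP[l ->] /asboolP[m ->]; apply/asboolP.
  by exists (l ++ m); rewrite big_cat.
- move=> a x /asboolP[l ->]; apply/asboolP.
  exists [seq (a * t.1, t.2) | t <- l]; rewrite scaler_sumr big_map.
  by apply: eq_bigr => t _; rewrite scalerA.
- move=> x y /asboolP[l ->] /asboolP[m ->]; apply/asboolP.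
  exists [seq (t.1 * u.1, t.2 ++ u.2) | t <- l, u <- m].
  rewrite big_allpairs_dep mulr_suml; apply: eq_bigr => t _.
  rewrite mulr_sumr; apply: eq_bigr => u _ /=.
  by rewrite big_cat -scalerAl -scalerAr scalerA.
Qed.
HB.instance Definition _ := GRing.isSubalgClosed.Build F (clifford q)
  even_clifford_pred even_clifford_subalg.

Record even_clifford := EvenClifford {
  even_clifford_val :> clifford q;
  _ : even_clifford_val \in even_clifford_pred
}.
HB.instance Definition _ := [isSub for even_clifford_val].
HB.instance Definition _ := [Choice of even_clifford by <:].
HB.instance Definition _ := [SubChoice_isSubAlgebra of even_clifford by <:].

End CliffordAlgebra.

Section Quaternion.
Variable F : fieldType.

(* [b, a): coordinates in the basis 1, i, j, i j, with i^2 = a and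
   j^2 + j = b. The signs, which come from the relation i j = - (j + 1) i, are
   irrelevant in characteristic 2, and make the product associative in every
   characteristic. *)
Definition quaternion (b a : F) := 'rV[F]_4.

Section Algebra.
Variables b a : F.
Local Notation Q := (quaternion b a).
HB.instance Definition _ := Vector.on Q.

Definition quat (x0 x1 x2 x3 : F) : Q := \row_k [:: x0; x1; x2; x3]`_k.
Definition quat_i : Q := quat 0 1 0 0.
Definition quat_j : Q := quat 0 0 1 0.

Definition quat_one : Q := quat 1 0 0 0.
Definition quat_mul (x y : Q) : Q :=
  let x0 := x 0 0 in let x1 := x 0 1 in
  let x2 := x 0 2%:R in let x3 := x 0 3%:R in
  let y0 := y 0 0 in let y1 := y 0 1 in
  let y2 := y 0 2%:R in let y3 := y 0 3%:R in
  quat (x0 * y0 + a * (x1 * y1) + b * (x2 * y2) - a * (x3 * y1)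
          - a * b * (x3 * y3))
       (x0 * y1 + x1 * y0 - x2 * y1 - b * (x2 * y3) + b * (x3 * y2))
       (x0 * y2 + x2 * y0 - x2 * y2 + a * (x1 * y3) - a * (x3 * y1))
       (x0 * y3 + x3 * y0 + x1 * y2 - x2 * y1 - x3 * y2).

Lemma quat_ext (x y : Q) : x 0 0 = y 0 0 -> x 0 1 = y 0 1 ->
  x 0 2%:R = y 0 2%:R -> x 0 3%:R = y 0 3%:R -> x = y.
Proof.
move=> e0 e1 e2 e3; apply/rowP; case; case=> [|[|[|[|//]]]] lt.
- by rewrite (_ : Ordinal _ = 0) //; apply: val_inj.
- by rewrite (_ : Ordinal _ = 1) //; apply: val_inj.
- by rewrite (_ : Ordinal _ = 2%:R) //; apply: val_inj.
- by rewrite (_ : Ordinal _ = 3%:R) //; apply: val_inj.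
Qed.

Fact quat_mulA : associative quat_mul.
Proof. by move=> x y z; apply: quat_ext; rewrite !mxE /= ?mxE /=; ring. Qed.
Fact quat_mul1 : left_id quat_one quat_mul.
Proof. by move=> x; apply: quat_ext; rewrite !mxE /= ?mxE /=; ring. Qed.
Fact quat_1mul : right_id quat_one quat_mul.
Proof. by move=> x; apply: quat_ext; rewrite !mxE /= ?mxE /=; ring. Qed.
Fact quat_mulDl : left_distributive quat_mul +%R.
Proof. by move=> x y z; apply: quat_ext; rewrite !mxE /= ?mxE /=; ring. Qed.
Fact quat_mulDr : right_distributive quat_mul +%R.
Proof. by move=> x y z; apply: quat_ext; rewrite !mxE /= ?mxE /=; ring. Qed.
Fact quat_1_neq0 : quat_one != 0.
Proof.
by apply/eqP => /rowP/(_ 0)/eqP; rewrite !mxE /= oner_eq0.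
Qed.
HB.instance Definition _ := GRing.Zmodule_isNzRing.Build Q
  quat_mulA quat_mul1 quat_1mul quat_mulDl quat_mulDr quat_1_neq0.

Fact quat_scaleAl c (x y : Q) : c *: (x * y) = (c *: x) * y.
Proof. by apply: quat_ext; rewrite !mxE /= ?mxE /=; ring. Qed.
HB.instance Definition _ := GRing.Lmodule_isLalgebra.Build F Q quat_scaleAl.
Fact quat_scaleAr c (x y : Q) : c *: (x * y) = x * (c *: y).
Proof. by apply: quat_ext; rewrite !mxE /= ?mxE /=; ring. Qed.
HB.instance Definition _ := GRing.Lalgebra_isAlgebra.Build F Q quat_scaleAr.
HB.instance Definition _ := Algebra_isFalgebra.Build F Q.

Lemma quat_1E : 1 = quat_one. Proof. by []. Qed.

Lemma quat_i2 : quat_i * quat_i = a%:A.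
Proof. by apply: quat_ext; rewrite quat_1E !mxE /= ?mxE /=; ring. Qed.

Lemma quat_j2 : quat_j * quat_j + quat_j = b%:A.
Proof. by apply: quat_ext; rewrite quat_1E !mxE /= ?mxE /=; ring. Qed.

Lemma quat_basis x0 x1 x2 x3 : quat x0 x1 x2 x3 =
  x0 *: 1 + x1 *: quat_i + x2 *: quat_j + x3 *: (quat_i * quat_j).
Proof. by apply: quat_ext; rewrite quat_1E !mxE /= ?mxE /=; ring. Qed.

Lemma quat_conj : 2%N \in [pchar F] -> a != 0 ->
  quat_i \is a GRing.unit /\ quat_i * quat_j * quat_i^-1 = quat_j + 1.
Proof.
move=> char2 a_neq0.
have ii : quat_i * (a^-1 *: quat_i) = 1.
  by rewrite -scalerAr quat_i2 scalerA mulVf // scale1r.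
have ii' : (a^-1 *: quat_i) * quat_i = 1.
  by rewrite -scalerAl quat_i2 scalerA mulVf // scale1r.
have Ui : quat_i \is a GRing.unit by apply/unitrP; exists (a^-1 *: quat_i).
split=> //; apply: (mulIr Ui); rewrite mulrVK //.
apply: quat_ext; rewrite quat_1E !mxE /= ?mxE /=; try ring.
by rewrite [RHS](_ : _ = - 1) ?oppr_pchar2 //; ring.
Qed.

End Algebra.
End Quaternion.

Section Tensor.
Variable F : fieldType.

(* An element of A (x) B is given by its coordinates in the basis
   e_i (x) f_j, where e and f are the library's bases of A and B. *)
Definition tensor (A B : falgType F) := 'M[F]_(\dim {:A}, \dim {:B}).

Section Algebra.
Variables A B : falgType F.
Local Notation T := (tensor A B).
Local Notation e := (vbasis {:A}).
Local Notation f := (vbasis {:B}).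
HB.instance Definition _ := Vector.on T.

Definition tens (u : A) (v : B) : T := \matrix_(i, j) (coord e i u * coord f j v).

Definition tens_mul (M N : T) : T :=
  \sum_i \sum_j \sum_k \sum_l
    (M i j * N k l) *: tens (e`_i * e`_k) (f`_j * f`_l).

Lemma tensDl u u' v : tens (u + u') v = tens u v + tens u' v.
Proof. by apply/matrixP=> i j; rewrite !mxE linearD mulrDl. Qed.
Lemma tensDr u v v' : tens u (v + v') = tens u v + tens u v'.
Proof. by apply/matrixP=> i j; rewrite !mxE linearD mulrDr. Qed.
Lemma tensZl c u v : tens (c *: u) v = c *: tens u v.
Proof. by apply/matrixP=> i j; rewrite !mxE linearZ mulrA. Qed.
Lemma tensZr c u v : tens u (c *: v) = c *: tens u v.
Proof. by apply/matrixP=> i j; rewrite !mxE linearZ mulrCA. Qed.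
Lemma tens_suml I (r : seq I) P (u : I -> A) v :
  tens (\sum_(i <- r | P i) u i) v = \sum_(i <- r | P i) tens (u i) v.
Proof.
by apply: (big_morph (tens^~ v)) => [x y|]; rewrite ?tensDl // -(scale0r 0)
  tensZl scale0r.
Qed.
Lemma tens_sumr I (r : seq I) P u (v : I -> B) :
  tens u (\sum_(i <- r | P i) v i) = \sum_(i <- r | P i) tens u (v i).
Proof.
by apply: (big_morph (tens u)) => [x y|]; rewrite ?tensDr // -(scale0r 0)
  tensZr scale0r.
Qed.

Lemma tens_basis (M : T) : M = \sum_i \sum_j M i j *: tens e`_i f`_j.
Proof.
rewrite [LHS]matrix_sum_delta; apply: eq_bigr => i _; apply: eq_bigr => j _.
congr (_ *: _); apply/matrixP=> k l; rewrite !mxE.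
rewrite !(coord_free _ _ (basis_free (vbasisP _))).
by rewrite (eq_sym k) (eq_sym l) -natrM mulnb.
Qed.

Lemma tens_ind (P : T -> Prop) : P 0 -> (forall M N, P M -> P N -> P (M + N)) ->
  (forall u v, P (tens u v)) -> forall M, P M.
Proof.
move=> P0 PD Pt M; rewrite (tens_basis M).
elim/big_ind: _ => // i _; elim/big_ind: _ => // j _.
by rewrite -tensZl.
Qed.

Lemma tens_mulDl : left_distributive tens_mul +%R.
Proof.
move=> M M' N; rewrite /tens_mul -big_split; apply: eq_bigr => i _ /=.
rewrite -big_split; apply: eq_bigr => j _ /=.
rewrite -big_split; apply: eq_bigr => k _ /=.
rewrite -big_split; apply: eq_bigr => l _ /=.
by rewrite mxE mulrDl scalerDl.
Qed.
Lemma tens_mulDr : right_distributive tens_mul +%R.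
Proof.
move=> M N N'; rewrite /tens_mul -big_split; apply: eq_bigr => i _ /=.
rewrite -big_split; apply: eq_bigr => j _ /=.
rewrite -big_split; apply: eq_bigr => k _ /=.
rewrite -big_split; apply: eq_bigr => l _ /=.
by rewrite mxE mulrDr scalerDl.
Qed.
Lemma tens_mulZl c M N : c *: tens_mul M N = tens_mul (c *: M) N.
Proof.
rewrite /tens_mul scaler_sumr; apply: eq_bigr => i _ /=.
rewrite scaler_sumr; apply: eq_bigr => j _ /=.
rewrite scaler_sumr; apply: eq_bigr => k _ /=.
rewrite scaler_sumr; apply: eq_bigr => l _ /=.
by rewrite mxE scalerA mulrA.
Qed.
Lemma tens_mulZr c M N : c *: tens_mul M N = tens_mul M (c *: N).
Proof.
rewrite /tens_mul scaler_sumr; apply: eq_bigr => i _ /=.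
rewrite scaler_sumr; apply: eq_bigr => j _ /=.
rewrite scaler_sumr; apply: eq_bigr => k _ /=.
rewrite scaler_sumr; apply: eq_bigr => l _ /=.
by rewrite mxE scalerA mulrCA.
Qed.
Lemma tens_mul0l N : tens_mul 0 N = 0.
Proof. by apply: (@addrI _ (tens_mul 0 N)); rewrite -tens_mulDl !addr0. Qed.
Lemma tens_mul0r M : tens_mul M 0 = 0.
Proof. by apply: (@addrI _ (tens_mul M 0)); rewrite -tens_mulDr !addr0. Qed.

Lemma tens_mulE u v u' v' :
  tens_mul (tens u v) (tens u' v') = tens (u * u') (v * v').
Proof.
rewrite {2}(coord_vbasis (memvf u)) {2}(coord_vbasis (memvf v)).
rewrite {2}(coord_vbasis (memvf u')) {2}(coord_vbasis (memvf v')).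
rewrite /tens_mul mulr_suml tens_suml; apply: eq_bigr => i _.
rewrite mulr_suml tens_sumr; apply: eq_bigr => j _.
rewrite mulr_sumr tens_suml; apply: eq_bigr => k _.
rewrite mulr_sumr tens_sumr; apply: eq_bigr => l _.
rewrite -!scalerAl -!scalerAr !(tensZl, tensZr) !scalerA !mxE.
by congr (_ *: _); ring.
Qed.

Fact tens_mulA : associative tens_mul.
Proof.
move=> x y z; elim/tens_ind: x => [|x x' IHx IHx'|u v].
- by rewrite !tens_mul0l.
- by rewrite !tens_mulDl IHx IHx'.
elim/tens_ind: y => [|y y' IHy IHy'|u' v'].
- by rewrite tens_mul0l tens_mul0r tens_mul0l.
- by rewrite tens_mulDl !tens_mulDr tens_mulDl IHy IHy'.
elim/tens_ind: z => [|z z' IHz IHz'|u'' v''].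
- by rewrite !tens_mul0r.
- by rewrite !tens_mulDr IHz IHz'.
by rewrite !tens_mulE !mulrA.
Qed.
Fact tens_mul1 : left_id (tens 1 1) tens_mul.
Proof.
elim/tens_ind=> [|x y IHx IHy|u v]; first exact: tens_mul0r.
- by rewrite tens_mulDr IHx IHy.
- by rewrite tens_mulE !mul1r.
Qed.
Fact tens_1mul : right_id (tens 1 1) tens_mul.
Proof.
elim/tens_ind=> [|x y IHx IHy|u v]; first exact: tens_mul0l.
- by rewrite tens_mulDl IHx IHy.
- by rewrite tens_mulE !mulr1.
Qed.
Fact tens_1_neq0 : tens 1 1 != 0.
Proof.
apply/negP => /eqP/matrixP t0.
have [i Ai] : exists i, coord e i 1 != 0.
  apply/existsP; apply: contraT; rewrite negb_exists => /forallP A0.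
  rewrite -(oner_eq0 A) (coord_vbasis (memvf 1)) big1 // => i _.
  by move/negPn/eqP: (A0 i) => ->; rewrite scale0r.
have [j Bj] : exists j, coord f j 1 != 0.
  apply/existsP; apply: contraT; rewrite negb_exists => /forallP B0.
  rewrite -(oner_eq0 B) (coord_vbasis (memvf 1)) big1 // => j _.
  by move/negPn/eqP: (B0 j) => ->; rewrite scale0r.
by have /eqP := t0 i j; rewrite !mxE mulf_eq0 (negPf Ai) (negPf Bj).
Qed.
HB.instance Definition _ := GRing.Zmodule_isNzRing.Build T
  tens_mulA tens_mul1 tens_1mul tens_mulDl tens_mulDr tens_1_neq0.
HB.instance Definition _ := GRing.Lmodule_isLalgebra.Build F T tens_mulZl.
HB.instance Definition _ := GRing.Lalgebra_isAlgebra.Build F T tens_mulZr.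
HB.instance Definition _ := Algebra_isFalgebra.Build F T.

Lemma tensM u v u' v' : tens u v * tens u' v' = tens (u * u') (v * v').
Proof. exact: tens_mulE. Qed.

End Algebra.

(* A_1 (x) (A_2 (x) ... (A_n (x) B)) *)
Definition tensor_seq (l : seq (falgType F)) (B : falgType F) : falgType F :=
  foldr (fun A T : falgType F => tensor A T : falgType F) B l.

(* b |-> 1 (x) ... (x) 1 (x) b *)
Fixpoint tensor_last (l : seq (falgType F)) (B : falgType F) :
    B -> tensor_seq l B :=
  match l with
  | [::] => fun b => b
  | A :: l' => fun b => tens (1 : A) (tensor_last l' b)
  end.

Fact tensor_last_linear l (B : falgType F) : linear (@tensor_last l B).
Proof.
by elim: l => //= A l IHl c x y; rewrite IHl tensDr tensZr.
Qed.
Fact tensor_last_monoid l (B : falgType F) : monoid_morphism (@tensor_last l B).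
Proof.
elim: l => //= A l [IH1 IHM]; split=> [|x y]; first by rewrite IH1.
by rewrite IHM tensM mulr1.
Qed.
HB.instance Definition _ l (B : falgType F) :=
  GRing.isLinear.Build F B (tensor_seq l B) _ (@tensor_last l B)
    (@tensor_last_linear l B).
HB.instance Definition _ l (B : falgType F) :=
  GRing.isMonoidMorphism.Build B (tensor_seq l B) (@tensor_last l B)
    (@tensor_last_monoid l B).

End Tensor.

(* The degree of a central simple K-algebra is the square root of its
   dimension; here A is a K-algebra through iota. The three conditions say that
   K is the center of A, that A is simple, and that A has a K-basis of d ^ 2
   elements. *)
Definition has_degree (K : fieldType) (A : nzRingType)
    (iota : {rmorphism K -> A}) (d : nat) : Prop :=
  [/\ forall x : A, (forall y, x * y = y * x) <-> (exists k, x = iota k),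
      forall I : A -> Prop,
        I 0 -> (forall x y, I x -> I y -> I (x + y)) ->
        (forall x y z, I y -> I (x * y * z)) ->
        (forall x, I x -> x = 0) \/ (forall x, I x)
    & exists e : 'I_(d ^ 2) -> A, forall x : A,
        exists! k : {ffun 'I_(d ^ 2) -> K}, x = \sum_i iota (k i) * e i].

Section Form.
Variables (F : fieldType) (n s : nat).

Definition singular_form (a b : 'I_n -> F) (c : 'rV[F]_s) :
    quadform ({ffun 'I_n -> 'rV[F]_2} * 'rV[F]_(1 + s))%type :=
  orth (orth_sum (fun i => qscale (a i) (binary 1 (b i))))
       (diag_form (row_mx 1%:M c)).

Definition quaternions (a b : 'I_n -> F) : seq (falgType F) :=
  [seq (quaternion (b i) (a i) : falgType F) | i <- enum 'I_n].

End Form.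

(* Main.v *)
From HB Require Import structures.
Require Import Defs.
From mathcomp Require Import all_boot all_algebra all_field.
From mathcomp Require Import boolp ring.

(** Write C_0 for the even Clifford algebra and T for the tensor product.

    In characteristic 2 the vectors of the diagonal part of the form are
    orthogonal to everything, so they are central in the Clifford algebra. Let w
    be the first basis vector of that part, of value 1. Multiplication by w is then a linear map
    v |-> [v] = v w into C_0 with [v]^2 = q v and [w] = 1, and its image
    generates C_0 because u v = [u] [v]. If u_i, v_i is the standard basis of
    the i-th plane, then [u_i] and a_i^-1 [u_i] [v_i] satisfy the relations of
    the generators i, j of [b_i, a_i); elements coming from distinct planes
    commute; and the remaining diagonal vectors give central square roots of the
    c_j. The universal properties of the quaternion algebras
    ([quaternion_univ]), of K ([multiquadratic_univ]) and of tensor products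
    ([tensor_seq_univ]) turn this into a morphism from T to C_0, which is onto
    since its image contains every [v] ([singular_even_surj]).

    The universal property of K is where the equality [K : F] = 2 ^ s matters:
    it says that the 2 ^ s products of distinct t_j are a basis of K, so that a
    map may be prescribed on them.

    Injectivity needs no information on the dimension of C_0, because T is
    simple. That T is simple, has center K, and has a K-basis of 4 ^ n elements
    is proved by adding one quaternion factor at a time ([tensor_seq_csa]). A
    quaternion algebra A enters through one property, [inner_forms]: every
    linear form on A is x |-> \sum p x q for some p, q in A. It implies that
    the coordinates in B of an element x of A (x) B lie in the two-sided ideal
    generated by x, and that x equals one of its coordinates up to a scalar
    if it is central. *)

Set Implicit Arguments.
Unset Strict Implicit.
Unset Printing Implicit Defensive.

Import GRing.Theory.
Local Open Scope ring_scope.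

(** * Maps out of a tensor product *)

Section TensorLift.
Variables (F : fieldType) (A B : falgType F) (E : lmodType F).
Variables (h : A -> B -> E).
Hypothesis h_linl : forall v, linear (h^~ v).
Hypothesis h_linr : forall u, linear (h u).

Let hl v : {linear A -> E} :=
  HB.pack (h^~ v) (GRing.isLinear.Build F A E _ (h^~ v) (h_linl v)).
Let hr u : {linear B -> E} :=
  HB.pack (h u) (GRing.isLinear.Build F B E _ (h u) (h_linr u)).

Definition tens_lift (M : tensor A B) : E :=
  \sum_i \sum_j M i j *: h (vbasis {:A})`_i (vbasis {:B})`_j.

Fact tens_lift_linear : linear tens_lift.
Proof.
move=> c M N; rewrite /tens_lift scaler_sumr -big_split; apply: eq_bigr => i _.
rewrite scaler_sumr -big_split; apply: eq_bigr => j _ /=.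
by rewrite !mxE scalerDl scalerA.
Qed.

Lemma tens_liftE u v : tens_lift (tens u v) = h u v.
Proof.
rewrite {2}(coord_vbasis (memvf u)) -[RHS]/(hl v _) linear_sum.
apply: eq_bigr => i _; rewrite linearZ /= {2}(coord_vbasis (memvf v)).
rewrite -[h _ _ in RHS]/(hr _ _) linear_sum scaler_sumr; apply: eq_bigr => j _.
by rewrite linearZ scalerA mxE.
Qed.

End TensorLift.

(** The commutation hypothesis is what makes u (x) v |-> f u * g v
    multiplicative. *)
Lemma tensor_univ (F : fieldType) (A B : falgType F) (E : algType F)
    (f : {lrmorphism A -> E}) (g : {lrmorphism B -> E}) :
    (forall u v, f u * g v = g v * f u) ->
  exists h : {lrmorphism tensor A B -> E}, forall u v, h (tens u v) = f u * g v.
Proof.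
move=> fg; pose m u v := f u * g v.
have ml v : linear (m^~ v).
  by move=> c x y; rewrite /m linearP mulrDl scalerAl.
have mr u : linear (m u).
  by move=> c x y; rewrite /m linearP mulrDr scalerAr.
have hE := tens_liftE ml mr.
pose hL := GRing.isLinear.Build F _ _ _ (tens_lift m) (tens_lift_linear m).
pose h0 : {linear tensor A B -> E} := HB.pack (tens_lift m) hL.
have h0E : tens_lift m 0 = 0 := raddf0 h0.
have hD x y : tens_lift m (x + y) = tens_lift m x + tens_lift m y := raddfD h0 x y.
have hM : monoid_morphism (tens_lift m).
  split=> [|x y]; first by rewrite hE /m !rmorph1 mul1r.
  elim/tens_ind: x => [|x x' IHx IHx'|u v]; first by rewrite mul0r h0E mul0r.
    by rewrite mulrDl !hD mulrDl IHx IHx'.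
  elim/tens_ind: y => [|y y' IHy IHy'|u' v']; first by rewrite mulr0 h0E mulr0.
    by rewrite mulrDr !hD mulrDr IHy IHy'.
  rewrite tensM !hE /m !rmorphM /= -!mulrA; congr (_ * _).
  by rewrite !mulrA fg.
pose hR := GRing.isMonoidMorphism.Build _ _ (tens_lift m) hM.
pose h : {lrmorphism tensor A B -> E} := HB.pack (tens_lift m) hL hR.
by exists h.
Qed.

(** The three conclusions are those that the induction and the applications
    need: the first lets the next factor be added, the other two say that the
    image contains the images of all the factors. *)
Lemma tensor_seq_univ (F : fieldType) (I : eqType) (Q : I -> falgType F)
    (K : falgType F) (E : algType F) (f : forall i, {lrmorphism Q i -> E})
    (g : {lrmorphism K -> E}) (r : seq I) :
    (forall i j, i != j -> forall x y, f i x * f j y = f j y * f i x) ->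
    (forall i x y, f i x * g y = g y * f i x) -> uniq r ->
  exists h : {lrmorphism tensor_seq [seq Q i | i <- r] K -> E},
    [/\ forall u, (forall i, i \in r -> forall x, u * f i x = f i x * u) ->
          (forall y, u * g y = g y * u) -> forall z, u * h z = h z * u,
        forall i, i \in r -> forall x, exists z, h z = f i x
      & forall y, exists z, h z = g y].
Proof.
move=> fC fgC; elim: r => [_|i r IHr /= /andP[ir r_uniq]].
  by exists g; split=> // y; exists y.
have [h [hC hf hg]] := IHr r_uniq.
have fhC u z : f i u * h z = h z * f i u.
  apply: hC => [j jr x|y]; last exact: fgC.
  by apply: fC; apply: contraNneq ir => ->.
have [h' h'E] := tensor_univ fhC.
exists h'; split.
- move=> u uf ug; elim/tens_ind => [|x y IHx IHy|x y].
  + by rewrite raddf0 mulr0 mul0r.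
  + by rewrite raddfD /= mulrDr mulrDl IHx IHy.
  + rewrite h'E mulrA uf ?mem_head // -mulrA hC ?mulrA // => j jr.
    by apply: uf; rewrite inE jr orbT.
- move=> j; rewrite inE => /orP[/eqP -> x|jr x].
    by exists (tens x 1); rewrite h'E rmorph1 mulr1.
  have [z zE] := hf j jr x.
  by exists (tens 1 z); rewrite h'E rmorph1 mul1r.
- move=> y; have [z zE] := hg y.
  by exists (tens 1 z); rewrite h'E rmorph1 mul1r.
Qed.

(** * Quaternion algebras *)

Section InnerOperators.
Variables (F : fieldType) (A : algType F).

(** The left-right multiplication operators, which preserve every two-sided
    ideal. *)
Definition inner_op (f : A -> A) :=
  exists l : seq (A * A), forall x, f x = \sum_(p <- l) p.1 * x * p.2.

Lemma inner_op_id : inner_op id.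
Proof. by exists [:: (1, 1)] => x; rewrite big_seq1 mul1r mulr1. Qed.

Lemma inner_opD f g : inner_op f -> inner_op g -> inner_op (fun x => f x + g x).
Proof.
by move=> [l fE] [m gE]; exists (l ++ m) => x; rewrite big_cat fE gE.
Qed.

Lemma inner_opM u v f : inner_op f -> inner_op (fun x => u * f x * v).
Proof.
move=> [l fE]; exists [seq (u * p.1, p.2 * v) | p <- l] => x.
rewrite fE big_map mulr_sumr mulr_suml; apply: eq_bigr => p _ /=.
by rewrite !mulrA.
Qed.

Lemma inner_opMl u f : inner_op f -> inner_op (fun x => u * f x).
Proof.
move=> /(inner_opM u 1)[l fE]; exists l => x; rewrite -fE; exact/esym/mulr1.
Qed.

Lemma inner_opMr v f : inner_op f -> inner_op (fun x => f x * v).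
Proof. by move=> /(inner_opM 1 v)[l fE]; exists l => x; rewrite -fE mul1r. Qed.

Lemma inner_opZ c f : inner_op f -> inner_op (fun x => c *: f x).
Proof.
move=> /(inner_opMl c%:A)[l fE]; exists l => x.
by rewrite -fE -scalerAl mul1r.
Qed.

Lemma inner_opB f g : inner_op f -> inner_op g -> inner_op (fun x => f x - g x).
Proof.
move=> inf /(inner_opZ (-1)) /(inner_opD inf)[l fgE]; exists l => x.
by rewrite -fgE scaleN1r.
Qed.

Lemma eq_inner_op f g : f =1 g -> inner_op f -> inner_op g.
Proof. by move=> fg [l fE]; exists l => x; rewrite -fg. Qed.

Lemma inner_op_comm u f : inner_op f -> inner_op (fun x => u * f x + f x * u).
Proof.
by move=> inf; apply: inner_opD; [apply: inner_opMl | apply: inner_opMr].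
Qed.

(** For a finite-dimensional algebra this amounts to being central simple: it
    says that the operators of rank one, hence all the operators, are
    left-right multiplications. *)
Definition inner_forms := forall phi : {scalar A}, inner_op (fun x => (phi x)%:A).

End InnerOperators.

Section Quaternion.
Variables (F : fieldType) (b a : F).
Hypothesis char2 : 2%N \in [pchar F].
Hypothesis a_neq0 : a != 0.
Notation Q := (quaternion b a).
Notation i := (quat_i b a).
Notation j := (quat_j b a).

Lemma addvv_pchar2 (V : lmodType F) (v : V) : v + v = 0.
Proof. by rewrite -[v]scale1r -scalerDl (addrr_pchar2 char2) scale0r. Qed.

Lemma quat_ad_i (x : Q) :
  i * x + x * i = - (x 0 2%:R *: i + (a * x 0 3%:R) *: 1).
Proof.
(* Once this double, which is zero, is added, the identity holds in every
   characteristic. *)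
rewrite -[RHS]addr0.
rewrite -(addvv_pchar2 (x 0 0 *: i + (a * x 0 1) *: 1)).
by apply: quat_ext; rewrite quat_1E !mxE /= ?mxE /=; ring.
Qed.

Lemma quat_ad_j (x : Q) :
  j * x + x * j = - (x 0 1 *: i + x 0 3%:R *: (i * j)).
Proof.
rewrite -[RHS]addr0.
rewrite -(addvv_pchar2 (x 0 0 *: j + x 0 2%:R *: (b%:A - j))).
by apply: quat_ext; rewrite quat_1E !mxE /= ?mxE /=; ring.
Qed.

Lemma quat_coordE (x : Q) :
  x = x 0 0 *: 1 + x 0 1 *: i + x 0 2%:R *: j + x 0 3%:R *: (i * j).
Proof. by rewrite -quat_basis; apply: quat_ext; rewrite !mxE. Qed.

(** Commuting with i, then with j, isolates the coordinates one at a time: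
    [j, [i, x]] = x_2 i, then [i, x] yields x_3, then [j, x] yields x_1, and x_0
    is what remains. Dividing by i uses i^2 = a != 0. *)
Lemma quaternion_inner_forms : inner_forms Q.
Proof.
pose Di (x : Q) := i * x + x * i; pose Dj (x : Q) := j * x + x * j.
have inI := inner_op_id Q.
have Di_in : inner_op Di by apply: inner_op_comm.
have DjDi_in : inner_op (fun x => Dj (Di x)) by apply: inner_op_comm.
have DjDiE x : Dj (Di x) = x 0 2%:R *: i.
  rewrite /Di /Dj quat_ad_i quat_ad_j.
  by rewrite quat_1E !mxE /= !(mulr0, mulr1, addr0, scale0r, oppr0, scaleNr, opprK).
have iV : i * (a^-1 *: i) = 1.
  by rewrite -scalerAr quat_i2 scalerA mulVf // scale1r.
have in2 : inner_op (fun x : Q => (x 0 2%:R)%:A).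
  apply: eq_inner_op (inner_opMr (a^-1 *: i) DjDi_in) => x /=.
  by rewrite DjDiE -scalerAl iV.
have in3 : inner_op (fun x : Q => (x 0 3%:R)%:A).
  apply: eq_inner_op (inner_opZ (- a^-1) (inner_opD Di_in DjDi_in)) => x /=.
  rewrite DjDiE /Di quat_ad_i opprD addrAC addNr add0r scaleNr scalerN opprK.
  by rewrite scalerA mulrA mulVf // mul1r.
have in1 : inner_op (fun x : Q => (x 0 1)%:A).
  have Dj_in : inner_op Dj by apply: inner_op_comm.
  apply: eq_inner_op
    (inner_opMr (- (a^-1 *: i)) (inner_opD Dj_in (inner_opMr (i * j) in3))) => x /=.
  by rewrite /Dj quat_ad_j -scalerAl mul1r opprD addrNK mulrNN -scalerAl iV.
have in0 : inner_op (fun x : Q => (x 0 0)%:A).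
  apply: eq_inner_op (inner_opB (inner_opB (inner_opB inI
    (inner_opMr (i * j) in3)) (inner_opMr j in2)) (inner_opMr i in1)) => x /=.
  by rewrite {1}(quat_coordE x) -!scalerAl !mul1r !addrK.
move=> phi; apply: (@eq_inner_op _ _ (fun x : Q =>
   phi 1 *: (x 0 0)%:A + phi i *: (x 0 1)%:A + phi j *: (x 0 2%:R)%:A
   + phi (i * j) *: (x 0 3%:R)%:A)) => [x|].
  by rewrite [in RHS](quat_coordE x) !linearD !linearZ /= !scalerA !scalerDl;
     congr (_ *: _ + _ *: _ + _ *: _ + _ *: _); exact: mulrC.
by do 3?[apply: inner_opD]; apply: inner_opZ.
Qed.

Lemma dim_quaternion : \dim {:Q} = 4.
Proof. by rewrite dimvf. Qed.

Section Universal.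
Variables (E : algType F) (I J : E).
Hypothesis I2 : I * I = a%:A.
Hypothesis J2 : J * J + J = b%:A.
Hypothesis IJ : I * J + J * I = I.

Lemma quaternion_univ : exists h : {lrmorphism Q -> E}, h i = I /\ h j = J.
Proof.
(* It suffices that the linear map with the right values on the basis 1, i, j,
   i j respects left multiplication by i and by j. *)
pose h0 (x : Q) : E :=
  (x 0 0)%:A + x 0 1 *: I + x 0 2%:R *: J + x 0 3%:R *: (I * J).
have hL : linear h0.
  move=> c x y; rewrite /h0 !mxE !scalerDl -!scalerA !scalerDr.
  by do 3!(rewrite [RHS]addrACA; congr (_ + _)).
pose h1 : {linear Q -> E} := HB.pack h0 (GRing.isLinear.Build F Q E _ h0 hL).
have hD x y : h0 (x + y) = h0 x + h0 y := raddfD h1 x y.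
have hZ c x : h0 (c *: x) = c *: h0 x := linearZ_LR h1 c x.
have hi : h0 i = I by rewrite /h0 !mxE /= !scale0r scale1r add0r !addr0.
have hj : h0 j = J by rewrite /h0 !mxE /= !scale0r scale1r !add0r !addr0.
have h1E : h0 1 = 1 by rewrite quat_1E /h0 !mxE /= !scale0r scale1r !addr0.
have ijE : i * j = quat b a 0 0 0 1.
  by apply: quat_ext; rewrite !mxE /= ?mxE /=; ring.
have hij : h0 (i * j) = I * J.
  by rewrite ijE /h0 !mxE /= !scale0r scale1r !add0r.
have hN x : h0 (- x) = - h0 x := raddfN h1 x.
have JJ : J * J = b%:A - J by rewrite -J2 addrK.
have JI : J * I = - I - I * J.
  apply: (addrI (I * J)); rewrite IJ addrCA subrr addr0.
  by apply/eqP; rewrite -subr_eq0 opprK addvv_pchar2.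
have jiE : j * i = - i - i * j.
  by rewrite ijE; apply: quat_ext; rewrite !mxE /= ?mxE /=; ring.
have JIJ : J * (I * J) = - (b *: I).
  rewrite mulrA JI mulrBl mulNr -mulrA JJ mulrBr -scalerAr mulr1.
  by rewrite opprB addKr.
have jij : j * (i * j) = - (b *: i).
  rewrite mulrA jiE mulrBl mulNr -mulrA (_ : j * j = b%:A - j).
    by rewrite mulrBr -scalerAr mulr1 opprB addKr.
  by rewrite -quat_j2 addrK.
have hMi x : h0 (i * x) = I * h0 x.
  rewrite [in LHS](quat_coordE x) !mulrDr -!scalerAr mulr1 [i * (i * j)]mulrA.
  rewrite quat_i2.
  rewrite -scalerAl mul1r !(hD, hZ) hij hi hj h1E /h0.
  by rewrite mulr1 [I * (I * J)]mulrA I2 -[a%:A * J]scalerAl mul1r.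
have hMj x : h0 (j * x) = J * h0 x.
  rewrite [in LHS](quat_coordE x) !mulrDr -!scalerAr mulr1 jij jiE.
  rewrite (_ : j * j = b%:A - j); last by rewrite -quat_j2 addrK.
  rewrite !(hD, hZ, hN) hij hi hj h1E /h0 mulr1 JI JIJ.
  by rewrite JJ.
have hM : monoid_morphism h0.
  split=> // x y; rewrite [in LHS](quat_coordE x) !mulrDl -!scalerAl mul1r.
  rewrite !(hD, hZ) -mulrA !(hMi, hMj).
  by rewrite mul1r mulrA.
pose h : {lrmorphism Q -> E} := HB.pack h0
  (GRing.isLinear.Build F Q E _ h0 hL) (GRing.isMonoidMorphism.Build _ _ h0 hM).
by exists h.
Qed.
End Universal.

End Quaternion.

Lemma quaternion_commute (F : fieldType) (b a : F) (E : algType F)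
    (h : {lrmorphism quaternion b a -> E}) (u : E) :
    u * h (quat_i b a) = h (quat_i b a) * u ->
    u * h (quat_j b a) = h (quat_j b a) * u ->
  forall x, u * h x = h x * u.
Proof.
move=> ui uj x; rewrite (quat_coordE x) !raddfD /= !linearZ /= rmorphM rmorph1.
rewrite !mulrDr !mulrDl -!scalerAr -!scalerAl mulr1 mul1r ui uj.
by rewrite mulrA ui -mulrA uj mulrA.
Qed.

(** * Simplicity, center and degree of a tensor product *)

Section CentralSimple.
Variables (K : fieldType) (A : nzRingType) (iota : {rmorphism K -> A}).

Definition is_center := forall x : A,
  (forall y, x * y = y * x) <-> (exists k, x = iota k).

Definition has_basis (I : finType) (e : I -> A) := forall x : A,
  exists! k : {ffun I -> K}, x = \sum_i iota (k i) * e i.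

End CentralSimple.

Definition simple_ring (A : nzRingType) := forall I : A -> Prop,
  I 0 -> (forall x y, I x -> I y -> I (x + y)) ->
  (forall x y z, I y -> I (x * y * z)) ->
  (forall x, I x -> x = 0) \/ (forall x, I x).

(** Bases indexed by any finite type are the ones that multiply under tensor
    products. *)
Lemma has_degreeI (K : fieldType) (A : nzRingType) (iota : {rmorphism K -> A})
    (I : finType) (e : I -> A) (d : nat) :
    is_center iota -> simple_ring A -> has_basis iota e -> #|I| = (d ^ 2)%N ->
  has_degree iota d.
Proof.
move=> cA sA eA card; split=> //; rewrite -card.
exists (fun i => e (enum_val i)) => x; have [k [xE k_uniq]] := eA x.
have reindexE (k' : {ffun I -> K}) (k'' : {ffun 'I_#|I| -> K}) :
    (forall i, k'' i = k' (enum_val i)) ->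
    \sum_i iota (k' i) * e i = \sum_i iota (k'' i) * e (enum_val i).
  move=> k'E; rewrite (reindex (@enum_val I I)) /=; last first.
    by exists enum_rank => i _; rewrite ?enum_valK ?enum_rankK.
  by apply: eq_bigr => i _; rewrite k'E.
exists [ffun i => k (enum_val i)]; split.
  by rewrite xE; apply: reindexE => i; rewrite ffunE.
move=> k' k'E; apply/ffunP=> i; rewrite ffunE.
rewrite (k_uniq [ffun i => k' (enum_rank i)]) ?ffunE ?enum_valK //.
by rewrite k'E; apply/esym/reindexE => {}i; rewrite ffunE enum_valK.
Qed.

Lemma has_degree_iso (K : fieldType) (A A' : nzRingType)
    (iota : {rmorphism K -> A}) (g : {rmorphism A -> A'}) (d : nat) :
  bijective g -> has_degree iota d -> has_degree (g \o iota) d.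
Proof.
move=> [g' gK g'K] [cA sA [e eA]]; split.
- move=> x; split=> [cx|[k ->] y].
    have /cA[k xE] : forall y, g' x * y = y * g' x.
      by move=> y; apply: (can_inj gK); rewrite !rmorphM g'K.
    by exists k; rewrite /= -xE g'K.
  have /cA comm : exists k', iota k = iota k' by exists k.
  by rewrite -(g'K y) /= -!rmorphM comm.
- move=> I I0 ID IM.
  have [|||I0'|IT] := sA (fun x => I (g x)).
  + by rewrite rmorph0.
  + by move=> x y Ix Iy; rewrite rmorphD; apply: ID.
  + by move=> x y z Iy; rewrite !rmorphM; apply: IM.
  + left=> x Ix; rewrite -(g'K x) (I0' (g' x)) ?rmorph0 //.
    by rewrite g'K.
  + by right=> x; rewrite -(g'K x).
- exists (g \o e) => x; have [k [xE k_uniq]] := eA (g' x).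
  have gE (k' : {ffun 'I_(d ^ 2) -> K}) :
      \sum_i (g \o iota) (k' i) * (g \o e) i = g (\sum_i iota (k' i) * e i).
    by rewrite rmorph_sum; apply: eq_bigr => i _; rewrite rmorphM.
  exists k; split; first by rewrite gE -xE g'K.
  by move=> k' xE'; apply: k_uniq; apply: (can_inj gK); rewrite g'K xE' gE.
Qed.

Section TensorStep.
Variables (F : fieldType) (A B : falgType F).
Notation e := (vbasis {:A}).

(** The map phi (x) id from A (x) B to F (x) B = B. *)
Definition slice (phi : {scalar A}) : tensor A B -> B :=
  tens_lift (fun u (v : B) => phi u *: v).

Lemma slice_tens phi u v : slice phi (tens u v) = phi u *: v.
Proof.
rewrite /slice tens_liftE // => [w|w] c x y.
  by rewrite linearP scalerDl scalerA.
by rewrite scalerDr !scalerA mulrC.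
Qed.

Fact slice_linear phi : linear (slice phi).
Proof. exact: tens_lift_linear. Qed.
HB.instance Definition _ phi :=
  GRing.isLinear.Build F (tensor A B) B _ (slice phi) (slice_linear phi).

Lemma tens0r (u : A) : tens u (0 : B) = 0.
Proof. by rewrite -[0 in LHS](scale0r 0) tensZr scale0r. Qed.

Lemma tensor_slices (x : tensor A B) :
  x = \sum_(i < \dim {:A}) tens e`_i (slice (coord e i) x).
Proof.
elim/tens_ind: x => [|x y IHx IHy|u v].
- by rewrite big1 // => i _; rewrite raddf0 tens0r.
- rewrite {1}IHx {1}IHy -big_split; apply: eq_bigr => i _.
  by rewrite raddfD tensDr.
- rewrite {1}(coord_vbasis (memvf u)) tens_suml; apply: eq_bigr => i _.
  by rewrite slice_tens tensZl tensZr.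
Qed.

Section Separating.
Hypothesis sepA : inner_forms A.

(** The operator that computes phi on A computes phi (x) id on A (x) B, as it
    does so on the pure tensors. *)
Lemma slice_inner (phi : {scalar A}) :
  exists l : seq (A * A), (forall x, (phi x)%:A = \sum_(p <- l) p.1 * x * p.2) /\
    forall x : tensor A B, tens 1 (slice phi x) =
      \sum_(p <- l) tens p.1 1 * x * tens p.2 1.
Proof.
have [l phiE] := sepA phi; exists l; split=> // x.
elim/tens_ind: x => [|x y IHx IHy|u v].
- by rewrite raddf0 tens0r big1 // => p _; rewrite mulr0 mul0r.
- rewrite raddfD tensDr IHx IHy -big_split; apply: eq_bigr => p _.
  by rewrite mulrDr mulrDl.
- rewrite slice_tens tensZr -tensZl phiE tens_suml; apply: eq_bigr => p _.
  by rewrite !tensM mul1r mulr1.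
Qed.

(** By [slice_inner] the slices of the elements of an ideal I lie in the ideal
    of the y in B such that 1 (x) y is in I. If that ideal is zero, so are all
    the slices, hence all the elements of I; otherwise it contains 1. *)
Lemma tensor_simple : simple_ring B -> simple_ring (tensor A B).
Proof.
move=> sB I I0 ID IM.
have Isum (l : seq (A * A)) f : (forall p, I (f p)) -> I (\sum_(p <- l) f p).
  by move=> If; elim/big_ind: _.
have slI phi x : I x -> I (tens 1 (slice phi x)).
  move=> Ix; have [l [_ ->]] := slice_inner phi.
  by apply: Isum => p; apply: IM.
have [|||J0|JT] := sB (fun y => I (tens 1 y)).
- by rewrite tens0r.
- by move=> x y Ix Iy; rewrite tensDr; apply: ID.
- move=> x y z Iy; have := IM (tens 1 x) _ (tens 1 z) Iy.
  by rewrite !tensM !mul1r.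
- left=> x Ix; rewrite (tensor_slices x) big1 // => i _.
  by rewrite (J0 _ (slI _ _ Ix)) tens0r.
right=> x; have := IM x _ 1 (JT 1).
by rewrite (_ : tens 1 1 = 1) // !mulr1.
Qed.

Lemma coord1_neq0 : exists i, coord e i 1 != 0.
Proof.
apply/existsP; apply: contraT; rewrite negb_exists => /forallP e0.
have := oner_neq0 A; rewrite (coord_vbasis (memvf 1)) big1 ?eqxx // => i _.
by move/negPn/eqP: (e0 i) => ->; rewrite scale0r.
Qed.

Lemma tens1_inj : injective (fun y : B => tens (1 : A) y).
Proof.
move=> y z yz; have [i ei] := coord1_neq0.
by apply: (scalerI ei); rewrite -!slice_tens yz.
Qed.

Variables (K : fieldType) (iB : {rmorphism K -> B}).
Variables (iT : {rmorphism K -> tensor A B}).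
Hypothesis iTE : forall k, iT k = tens 1 (iB k).

(** If x is central and phi = \sum p _ q, then 1 (x) (phi (x) id)(x) =
    (\sum p q (x) 1) x = phi(1) x; so x is a slice of itself as soon as
    phi(1) != 0. *)
Lemma tensor_center : is_center iB -> is_center iT.
Proof.
move=> cB x; split=> [cx|[k ->] y]; last first.
  have /cB kC : exists k', iB k = iB k' by exists k.
  rewrite iTE; elim/tens_ind: y => [|y z IHy IHz|u v].
  - by rewrite mulr0 mul0r.
  - by rewrite mulrDr mulrDl IHy IHz.
  - by rewrite !tensM mulr1 mul1r kC.
have [i ei] := coord1_neq0.
have xE : x = tens 1 ((coord e i 1)^-1 *: slice (coord e i) x).
  have [l [lE slE]] := slice_inner (coord e i).
  rewrite tensZr slE (_ : \sum_(p <- l) _ = coord e i 1 *: x).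
    by rewrite scalerA mulVf // scale1r.
  rewrite -[x in RHS]mul1r scalerAl (_ : 1 = tens 1 1 :> tensor A B) //.
  rewrite -tensZl lE.
  rewrite tens_suml mulr_suml; apply: eq_bigr => p _.
  by rewrite -mulrA cx mulrA tensM !mulr1.
have /cB[k kE] : forall y, (coord e i 1)^-1 *: slice (coord e i) x * y =
    y * ((coord e i 1)^-1 *: slice (coord e i) x).
  move=> y; apply: tens1_inj; have := cx (tens 1 y).
  by rewrite {1 2}xE !tensM mul1r.
by exists k; rewrite iTE -kE.
Qed.

Lemma tensor_has_basis (I : finType) (f : I -> B) : has_basis iB f ->
  has_basis iT (fun p : 'I_(\dim {:A}) * I => tens e`_(p.1) (f p.2)).
Proof.
move=> fB x.
have sumE (k : {ffun 'I_(\dim {:A}) * I -> K}) :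
    \sum_p iT (k p) * tens e`_(p.1) (f p.2) =
    \sum_(i < \dim {:A}) tens e`_i (\sum_j iB (k (i, j)) * f j).
  under [RHS]eq_bigr do rewrite tens_sumr.
  rewrite [RHS]pair_bigA /=; apply: eq_bigr => -[i j] _ /=.
  by rewrite iTE tensM mul1r.
have sliceE (y : 'I_(\dim {:A}) -> B) i :
    slice (coord e i) (\sum_(j < \dim {:A}) tens e`_j (y j)) = y i.
  rewrite linear_sum (bigD1 i) //= slice_tens big1 => [|j ji].
    by rewrite /= coord_free ?(basis_free (vbasisP _)) // eqxx scale1r addr0.
  rewrite slice_tens /= coord_free ?(basis_free (vbasisP _)) //.
  by rewrite (negPf ji) scale0r.
have /choice[k kE] i := fB (slice (coord e i) x).
exists [ffun p => k p.1 p.2]; split.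
  rewrite sumE {1}(tensor_slices x); apply: eq_bigr => i _.
  by have [-> _] := kE i; congr tens; apply: eq_bigr => j _; rewrite ffunE.
move=> k' xE; apply/ffunP=> -[i j]; rewrite ffunE /=.
have [_ k_uniq] := kE i.
rewrite (k_uniq [ffun j => k' (i, j)]) ?ffunE // xE sumE sliceE.
by apply: eq_bigr => {}j _; rewrite ffunE.
Qed.

End Separating.
End TensorStep.

Lemma tensor_seq_csa (F : fieldType) (K : fieldExtType F) (I : Type)
    (Q : I -> falgType F) (N : nat) (r : seq I) :
    (forall i, inner_forms (Q i)) -> (forall i, \dim {:Q i} = N) ->
  let iota := @tensor_last F [seq Q i | i <- r] K in
  [/\ is_center iota, simple_ring (tensor_seq [seq Q i | i <- r] K) &
    exists (J : finType) (e : J -> tensor_seq [seq Q i | i <- r] K),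
      has_basis iota e /\ #|J| = (N ^ size r)%N].
Proof.
move=> sepQ dimQ; elim: r => [|i r [cr sr [J [e [eb cardJ]]]]] /=.
  split.
  - by move=> x; split=> [_|_ y]; [exists x | apply: mulrC].
  - move=> I0 I00 ID IM; have [IT|nIT] := pselect (I0 1).
      by right=> x; rewrite -[x]mulr1 -[x * 1]mulr1; apply: IM.
    left=> x Ix; apply/eqP; apply: contra_notT nIT => x_neq0.
    by rewrite -(mulVf x_neq0) -[_ * x]mulr1; apply: IM.
  - exists unit, (fun=> 1); split; last by rewrite card_unit.
    move=> x; have sumE (k : {ffun unit -> K}) : \sum_i k i * 1 = k tt.
      by rewrite (big_pred1 tt) ?mulr1 // => -[].
    exists [ffun=> x]; split; first by rewrite sumE ffunE.
    by move=> k ->; apply/ffunP => -[]; rewrite ffunE sumE.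
split.
- exact: (tensor_center (sepQ i) (iB := @tensor_last F [seq Q i | i <- r] K)).
- exact: tensor_simple.
- exists ('I_(\dim {:Q i}) * J)%type.
  exists (fun p : 'I_(\dim {:Q i}) * J => tens (vbasis {:Q i})`_(p.1) (e p.2)).
  split.
    exact: (tensor_has_basis _ eb).
  by rewrite card_prod card_ord dimQ cardJ expnS.
Qed.

(** * Extensions generated by square roots *)

Section Monomials.

(** The products of the subfamilies of l, in the order of l. *)
Fixpoint monomials (R : nzRingType) (l : seq R) : seq R :=
  if l is g :: l' then monomials l' ++ [seq g * m | m <- monomials l']
  else [:: 1].

Lemma size_monomials (R : nzRingType) (l : seq R) :
  size (monomials l) = (2 ^ size l)%N.
Proof.
elim: l => //= g l IHl.
by rewrite size_cat size_map IHl addnn -mul2n expnS.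
Qed.

Lemma monomials_map (R S : nzRingType) (f : {rmorphism R -> S}) (l : seq R) :
  monomials (map f l) = map f (monomials l).
Proof.
elim: l => [|g l IHl] /=; first by rewrite rmorph1.
rewrite map_cat IHl -!map_comp; congr (_ ++ _).
by apply: eq_map => m /=; rewrite rmorphM.
Qed.

Lemma monomials1 (R : nzRingType) (l : seq R) : 1 \in monomials l.
Proof. by elim: l => [|g l IHl] /=; rewrite ?mem_head // mem_cat IHl. Qed.

Lemma monomials_ind (R : nzRingType) (l : seq R) (P : R -> Prop) :
    P 1 -> (forall g z, g \in l -> P z -> P (g * z)) ->
  forall z, z \in monomials l -> P z.
Proof.
move=> P1; elim: l => [|g l IHl] PM z /=; first by rewrite inE => /eqP ->.
have {}IHl z' : z' \in monomials l -> P z'.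
  by apply: IHl => h y hl; apply: PM; rewrite inE hl orbT.
rewrite mem_cat => /orP[/IHl //|/mapP[m /IHl Pm ->]].
by apply: PM; rewrite ?mem_head.
Qed.

(** Hence the span of the monomials is stable under the generators. The algebra
    is arbitrary so that the lemma can be applied to a product of two algebras,
    where it gives the same d and corresponding monomials z' in both. *)
Lemma monomials_mul (F : fieldType) (A : algType F) (l : seq A) :
    (forall g, g \in l -> exists d : F, g * g = d%:A) ->
    {in l &, forall g h, g * h = h * g} ->
  forall g z, g \in l -> z \in monomials l ->
    exists d : F, exists2 z', z' \in monomials l & g * z = d *: z'.
Proof.
elim: l => [//|g0 l IHl] sq comm g z /=; rewrite inE mem_cat.
have inl h : h \in l -> h \in g0 :: l by rewrite inE orbC => ->.
have {}IHl := IHl (fun h hl => sq h (inl h hl))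
  (fun h h' hl hl' => comm h h' (inl h hl) (inl h' hl')).
have lmon z' : z' \in monomials l ->
    z' \in monomials l ++ [seq g0 * m | m <- monomials l].
  by rewrite mem_cat => ->.
have rmon z' : z' \in monomials l ->
    g0 * z' \in monomials l ++ [seq g0 * m | m <- monomials l].
  by move=> z'l; rewrite mem_cat map_f ?orbT.
case/orP=> [/eqP -> | gl] /orP[zl|/mapP[m ml ->]].
- by exists 1, (g0 * z); rewrite ?scale1r ?rmon.
- have [d g02] := sq g0 (mem_head _ _).
  by exists d, m; rewrite ?lmon // mulrA g02 -scalerAl mul1r.
- have [d [z' z'l ->]] := IHl g z gl zl.
  by exists d, z'; rewrite ?lmon.
- have [d [z' z'l gm]] := IHl g m gl ml.
  exists d, (g0 * z'); rewrite ?rmon // mulrA (comm g g0 (inl g gl) (mem_head _ _)).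
  by rewrite -mulrA gm scalerAr.
Qed.

End Monomials.

Lemma span_ind (F : fieldType) (V : vectType F) (X : seq V) (P : V -> Prop) :
    P 0 -> (forall a u v, u \in X -> P v -> P (a *: u + v)) ->
  forall v, v \in <<X>>%VS -> P v.
Proof.
move=> P0 PX v /(coord_span (X := in_tuple X)) ->.
by elim/big_rec: _ => // i y _; apply: PX; apply: mem_nth.
Qed.

Section MultiQuadratic.
Variables (F : fieldType) (s : nat) (K : fieldExtType F) (t : 'I_s -> K).
Variables (c : 'I_s -> F).
Hypothesis t_sqr : forall j, t j * t j = (c j)%:A.
Hypothesis t_gen : <<1 & [seq t j | j <- enum 'I_s]>>%VS = {:K}%VS.
Hypothesis K_dim : \dim {:K} = (2 ^ s)%N.
Let ts := [seq t j | j <- enum 'I_s].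

Lemma monomials_span : <<monomials ts>>%VS = {:K}%VS.
Proof.
apply/eqP; rewrite eqEsubv subvf -t_gen.
apply: agenv_sub_modl; first by rewrite -memvE memv_span ?monomials1.
rewrite prodvDl prod1v subv_add subvv /=; apply/prodvP=> u v us vm.
elim/span_ind: us => [|a g w g_in IHw]; first by rewrite mul0r mem0v.
rewrite mulrDl memvD //; elim/span_ind: vm => [|d m w' m_in IHw'].
  by rewrite mulr0 mem0v.
rewrite mulrDr memvD // -scalerAl -scalerAr !memvZ //.
have [h /mapP[j _ ->]|h h' _ _|//|//|e [z z_in ->]] :=
  @monomials_mul F K ts _ _ g m.
- by exists (c j).
- exact: mulrC.
- by rewrite memvZ ?memv_span.
Qed.

Lemma monomials_basis : basis_of {:K} (monomials ts).
Proof.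
rewrite basisEdim -monomials_span subvv monomials_span K_dim.
by rewrite size_monomials size_map size_enum_ord leqnn.
Qed.

Lemma multiquadratic_ind (P : K -> Prop) : P 1 ->
  (forall a x y, P x -> P y -> P (a *: x + y)) ->
  (forall j x, P x -> P (t j * x)) -> forall x, P x.
Proof.
move=> P1 PL PM x; have P0 : P 0.
  by have := PL (-1) _ _ P1 P1; rewrite scaleN1r addNr.
have := memvf x; rewrite -monomials_span; elim/span_ind=> // a m y m_in Py.
apply: PL => //; apply: (@monomials_ind _ ts) m_in => // g z /mapP[j _ ->].
exact: PM.
Qed.

Variables (E : algType F) (tau : 'I_s -> E).
Hypothesis tau_sqr : forall j, tau j * tau j = (c j)%:A.
Hypothesis tauC : forall i j, tau i * tau j = tau j * tau i.

(** The map is prescribed on the basis of monomials in the t_j, with values the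
    monomials in the tau_j. As [monomials_mul] holds for the generators
    (t_j, tau_j) of a product algebra, multiplications by t_j and by tau_j follow
    the same formulas on the two families of monomials. *)
Lemma multiquadratic_univ :
  exists h : {lrmorphism K -> E}, forall j, h (t j) = tau j.
Proof.
pose gs : seq (K * E)%type := [seq (t j, tau j) | j <- enum 'I_s].
pose Ms := monomials gs.
have M1 : monomials ts = map fst Ms.
  by rewrite -(monomials_map fst) -map_comp.
have szM : size (monomials ts) = size Ms by rewrite M1 size_map.
pose h0 (x : K) : E := \sum_(i < size (monomials ts))
  coord (in_tuple (monomials ts)) i x *: (Ms`_i).2.
have hL : linear h0.
  move=> d x y; rewrite /h0 scaler_sumr -big_split; apply: eq_bigr => i _.
  by rewrite linearP scalerDl scalerA.
pose h1 : {linear K -> E} := HB.pack h0 (GRing.isLinear.Build F K E _ h0 hL).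
have hP d x y : h0 (d *: x + y) = d *: h0 x + h0 y := hL d x y.
have h00 : h0 0 = 0 := raddf0 h1.
have hZ d x : h0 (d *: x) = d *: h0 x := linearZ_LR h1 d x.
have frM : free (in_tuple (monomials ts)).
  exact: basis_free monomials_basis.
have hM z : z \in Ms -> h0 z.1 = z.2.
  case/(nthP 0)=> k; rewrite -szM => k_lt <-.
  have -> : (Ms`_k).1 = (in_tuple (monomials ts))`_(Ordinal k_lt).
    by rewrite /= M1 (nth_map 0) // -szM.
  rewrite /h0 (bigD1 (Ordinal k_lt)) // big1 => [|i ik].
    by rewrite coord_free // eqxx /= scale1r addr0.
  by rewrite coord_free // eq_sym (negPf ik) scale0r.
have htM j x : h0 (t j * x) = tau j * h0 x.
  have := memvf x; rewrite -monomials_span; elim/span_ind=> [|a m y m_in IHy].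
    by rewrite mulr0 h00 mulr0.
  rewrite mulrDr -scalerAr !hP IHy mulrDr -scalerAr; congr (_ *: _ + _).
  move: m_in; rewrite M1 => /mapP[z zM ->].
  have [|g h|||d [z' z'M zE]] := @monomials_mul F (K * E)%type gs _ _ (t j, tau j) z.
  - move=> g /mapP[k _ ->]; exists (c k).
    exact: congr2 (t_sqr k) (tau_sqr k).
  - move=> /mapP[k _ ->] /mapP[k' _ ->].
    exact: congr2 (mulrC (t k) (t k')) (tauC k k').
  - by rewrite map_f ?mem_enum.
  - by [].
  rewrite -[t j * z.1]/((t j, tau j) * z).1 zE hZ (hM z zM).
  by rewrite (hM z' z'M) -[RHS]/((t j, tau j) * z).2 zE.
have h11 : h0 1 = 1 by apply: (hM 1); apply: monomials1.
have hMM x y : h0 (x * y) = h0 x * h0 y.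
  elim/multiquadratic_ind: x => [|d x x' IHx IHx'|j x IHx].
  - by rewrite h11 !mul1r.
  - by rewrite mulrDl -scalerAl !hP IHx IHx' mulrDl scalerAl.
  - by rewrite -mulrA !htM IHx mulrA.
pose h : {lrmorphism K -> E} := HB.pack h0 (GRing.isLinear.Build F K E _ h0 hL)
  (GRing.isMonoidMorphism.Build _ _ h0 (conj h11 hMM)).
by exists h => j; rewrite -[t j]mulr1 /= htM h11 mulr1.
Qed.

End MultiQuadratic.

(** * The even Clifford algebra in the presence of a radical vector *)

Lemma square_polar (F : fieldType) (V : lmodType F) (q : quadform V)
    (A : algType F) (f : {linear V -> A}) :
    (forall v, f v * f v = (q v)%:A) ->
  forall u v, f u * f v + f v * f u = (polar q u v)%:A.
Proof.
move=> f2 u v; rewrite /polar !scalerBl -!f2 linearD mulrDl !mulrDr.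
rewrite addrAC !addrA addrK [f u * f u + _]addrC.
by rewrite [X in _ = X - _]addrAC addrK.
Qed.

Section EvenClifford.
Variables (F : fieldType) (V : vectType F) (q : quadform V).
Hypothesis char2 : 2%N \in [pchar F].
Notation C0 := (even_clifford q).

Fact even_pair_subproof u v : cl_vec q u * cl_vec q v \in @even_clifford_pred F V q.
Proof.
by apply/asboolP; exists [:: (1, [:: (u, v)])]; rewrite !big_seq1 scale1r.
Qed.
Definition even_pair u v : C0 := EvenClifford (even_pair_subproof u v).

(** A name for the inclusion, to which the structure of an algebra morphism can
    be attached. *)
Definition even_val : C0 -> clifford q := @even_clifford_val F V q.
Fact even_val_linear : linear even_val. Proof. by []. Qed.
Fact even_val_monoid : monoid_morphism even_val. Proof. by []. Qed.
HB.instance Definition _ :=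
  GRing.isLinear.Build F C0 (clifford q) _ even_val even_val_linear.
HB.instance Definition _ :=
  GRing.isMonoidMorphism.Build C0 (clifford q) even_val even_val_monoid.
Lemma even_val_inj : injective even_val. Proof. exact: val_inj. Qed.
Lemma even_val_pair u v : even_val (even_pair u v) = cl_vec q u * cl_vec q v.
Proof. by []. Qed.

Lemma even_clifford_ind (P : C0 -> Prop) : P 1 ->
    (forall a x y, P x -> P y -> P (a *: x + y)) ->
    (forall u v x, P x -> P (even_pair u v * x)) ->
  forall x, P x.
Proof.
move=> P1 PL PM x; have P0 : P 0.
  by have := PL (-1) _ _ P1 P1; rewrite scaleN1r addNr.
have /asboolP[l xE] := valP x.
have -> : x = \sum_(t <- l) t.1 *: \prod_(p <- t.2) even_pair p.1 p.2.
  apply: even_val_inj; rewrite [LHS]xE raddf_sum; apply: eq_bigr => t _.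
  by rewrite -[RHS]/(t.1 *: even_val _) rmorph_prod.
elim/big_rec: _ => // t y _ Py; apply: PL => //.
by elim/big_rec: _ => // p z _; apply: PM.
Qed.

Variable w : V.
Hypothesis qw : q w = 1.
Hypothesis w_radical : forall v, polar q v w = 0.

Lemma cl_vec_radical v : cl_vec q v * cl_vec q w = cl_vec q w * cl_vec q v.
Proof.
have := square_polar (@cl_vec2 F V q) v w; rewrite w_radical scale0r => /eqP.
by rewrite addr_eq0 => /eqP ->; apply/eqP; rewrite -subr_eq0 -opprD
  (addvv_pchar2 char2) oppr0.
Qed.

(** Since w is central of square 1, this embeds the whole space in the even
    part without changing squares, and sends w to 1. *)
Definition even_vec v : C0 := even_pair v w.

Fact even_vec_linear : linear even_vec.
Proof.
move=> a u v; apply: even_val_inj.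
by rewrite [RHS]linearP !even_val_pair linearP mulrDl /= -scalerAl.
Qed.
HB.instance Definition _ := GRing.isLinear.Build F V C0 _ even_vec even_vec_linear.

Lemma even_pairE u v : even_pair u v = even_vec u * even_vec v.
Proof.
apply: even_val_inj; rewrite rmorphM !even_val_pair mulrA -[_ * _ * cl_vec q v]mulrA.
rewrite -[cl_vec q w * _]cl_vec_radical mulrA -mulrA cl_vec2 qw.
by rewrite scale1r mulr1.
Qed.

Lemma even_vec2 v : even_vec v * even_vec v = (q v)%:A.
Proof.
by rewrite -even_pairE; apply: even_val_inj; rewrite even_val_pair cl_vec2.
Qed.

Lemma even_vec_w : even_vec w = 1.
Proof.
by apply: even_val_inj; rewrite even_val_pair cl_vec2 qw scale1r rmorph1.
Qed.

End EvenClifford.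

(** * The singular form *)

Section SingularForm.
Variables (F : fieldType) (n s : nat) (a b : 'I_n -> F) (c : 'rV[F]_s).
Hypothesis char2 : 2%N \in [pchar F].
Notation V := ({ffun 'I_n -> 'rV[F]_2} * 'rV[F]_(1 + s))%type.
Notation phi := (singular_form a b c).

Definition plane (i : 'I_n) (p : 'rV[F]_2) : V :=
  ([ffun k => if k == i then p else 0], 0).
Definition axis (j : 'I_(1 + s)) : V := (0, delta_mx 0 j).

Lemma singular_formE x : phi x =
  \sum_i a i * (x.1 i 0 0 ^+ 2 + x.1 i 0 0 * x.1 i 0 1 + b i * x.1 i 0 1 ^+ 2)
  + \sum_j row_mx 1%:M c 0 j * x.2 0 j ^+ 2.
Proof.
congr (_ + _); apply: eq_bigr => i _.
by rewrite /= /qscale_fun /= /binary_fun mul1r.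
Qed.

Lemma singular_plane i p :
  phi (plane i p) = a i * (p 0 0 ^+ 2 + p 0 0 * p 0 1 + b i * p 0 1 ^+ 2).
Proof.
rewrite singular_formE (bigD1 i) //= !ffunE eqxx big1 => [|k ki].
  by rewrite big1 ?addr0 // => j _; rewrite [X in _ * X ^+ _]mxE expr0n mulr0.
by rewrite ffunE (negPf ki) /= !mxE !expr0n !mulr0 !addr0 mulr0.
Qed.

Lemma singular_axis j : phi (axis j) = row_mx 1%:M c 0 j.
Proof.
rewrite singular_formE big1 => [|i _]; last first.
  by rewrite ffunE !mxE !expr0n !mulr0 !addr0 mulr0.
rewrite add0r (bigD1 j) //= big1 => [|k kj].
  by rewrite [X in _ * X ^+ _]mxE !eqxx expr1n mulr1 addr0.
by rewrite [X in _ * X ^+ _]mxE (negPf kj) andbF expr0n mulr0.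
Qed.

(** The diagonal part contributes only doubles, and so do the squares in the
    planes. *)
Lemma singular_polar x y : polar phi x y =
  \sum_i a i * (x.1 i 0 0 * y.1 i 0 1 + x.1 i 0 1 * y.1 i 0 0).
Proof.
have two0 : 2%:R = 0 :> F by have := pcharf0 char2.
rewrite /polar !singular_formE.
have regroup (p1 p2 q1 q2 r1 r2 : F) :
  p1 + p2 - (q1 + q2) - (r1 + r2) = (p1 - q1 - r1) + (p2 - q2 - r2) by ring.
rewrite regroup -!sumrB [X in _ + X]big1 ?addr0 => [|j _]; last first.
  rewrite [X in _ * X ^+ _]mxE.
  rewrite [LHS](_ : _ = 2%:R * (row_mx 1%:M c 0 j * x.2 0 j * y.2 0 j)).
    by rewrite two0 mul0r.
  by ring.
apply: eq_bigr => i _; rewrite ffunE !mxE.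
rewrite [LHS](_ : _ = a i * (x.1 i 0 0 * y.1 i 0 1 + x.1 i 0 1 * y.1 i 0 0)
  + 2%:R * (a i * (x.1 i 0 0 * y.1 i 0 0 + b i * x.1 i 0 1 * y.1 i 0 1))).
  by rewrite two0 mul0r addr0.
by ring.
Qed.

Lemma singular_polar_axis x j : polar phi x (axis j) = 0.
Proof.
rewrite singular_polar big1 // => i _.
by rewrite ffunE !mxE !mulr0 addr0 mulr0.
Qed.

Lemma singular_polar_plane i k p p' : polar phi (plane i p) (plane k p') =
  if i == k then a i * (p 0 0 * p' 0 1 + p 0 1 * p' 0 0) else 0.
Proof.
rewrite singular_polar (bigD1 i) //= big1 => [|l li].
  rewrite !ffunE eqxx addr0; case: eqP => // _.
  by rewrite !mxE !mulr0 addr0 mulr0.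
by rewrite !ffunE (negPf li) !mxE !mul0r addr0 mulr0.
Qed.

Lemma singular_form_ind (P : V -> Prop) :
    (forall d x y, P x -> P y -> P (d *: x + y)) -> P 0 ->
    (forall i, P (plane i (delta_mx 0 0))) ->
    (forall i, P (plane i (delta_mx 0 1))) -> (forall j, P (axis j)) ->
  forall x, P x.
Proof.
move=> PL P0 P1 P2 Pw x; have -> : x =
    \sum_i (x.1 i 0 0 *: plane i (delta_mx 0 0)
            + x.1 i 0 1 *: plane i (delta_mx 0 1))
    + \sum_j x.2 0 j *: axis j.
  rewrite [LHS]surjective_pairing [RHS]surjective_pairing; congr (_, _).
    rewrite [RHS]/= !(raddf_sum fst) /= [X in _ + X]big1 ?addr0 => [|j _].
      apply/ffunP=> i; rewrite sum_ffunE (bigD1 i) //= big1 => [|k ki].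
        rewrite !ffunE eqxx addr0; apply/rowP; case=> [[|[|//]] lt2].
          rewrite (_ : Ordinal _ = 0) ?mxE ?mulr1 ?mulr0 ?addr0 //.
          exact: val_inj.
        rewrite (_ : Ordinal _ = 1) ?mxE ?mulr1 ?mulr0 ?add0r //.
        exact: val_inj.
      by rewrite !ffunE eq_sym (negPf ki) !scaler0 addr0.
    by rewrite scaler0.
  rewrite [RHS]/= !(raddf_sum snd) /= big1 ?add0r => [|i _].
    exact: row_sum_delta.
  by rewrite !scaler0 addr0.
have PD y z : P y -> P z -> P (y + z).
  by move=> Py Pz; rewrite -[y]scale1r; apply: PL.
have PZ d y : P y -> P (d *: y) by move=> Py; rewrite -[_ *: _]addr0; apply: PL.
apply: (PD); (apply: big_ind => [|y z|k _]; [exact: P0 | exact: PD |]).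
  by apply: PD; apply: PZ.
exact: PZ.
Qed.

End SingularForm.

(** * The isomorphism *)

Section SingularEven.
Variables (F : fieldType) (n s : nat) (a b : 'I_n -> F) (c : 'rV[F]_s).
Hypothesis char2 : 2%N \in [pchar F].
Hypothesis a_neq0 : forall i, a i != 0.
Variables (K : fieldExtType F) (t : 'I_s -> K).
Hypothesis t_sqr : forall j, t j ^+ 2 = (c 0 j)%:A.
Hypothesis t_gen : <<1 & [seq t j | j <- enum 'I_s]>>%VS = {:K}%VS.
Hypothesis K_dim : \dim {:K} = (2 ^ s)%N.
Notation phi := (singular_form a b c).
Notation C0 := (even_clifford phi).
Notation T := (tensor_seq (quaternions a b) K).

(** With mu = [even_vec], the generators i, j of the k-th quaternion algebra go
    to mu u and a_k^-1 mu u mu v, where u, v is the standard basis of the k-th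
    plane, and t_j goes to mu of the j-th of the last s diagonal vectors. *)
Lemma singular_even_surj :
  exists h : {lrmorphism T -> C0}, forall x, exists z, h z = x.
Proof.
pose w : {ffun 'I_n -> 'rV[F]_2} * 'rV[F]_(1 + s) := axis F n (lshift s 0).
pose mu := even_vec phi w.
have qw : phi w = 1 by rewrite singular_axis row_mxEl mxE.
have radw v : polar phi v w = 0 by apply: singular_polar_axis.
have mu2 v : mu v * mu v = (phi v)%:A by apply: even_vec2.
have mu_polar u v : mu u * mu v + mu v * mu u = (polar phi u v)%:A.
  exact: (square_polar mu2).
have muC u v : polar phi u v = 0 -> mu u * mu v = mu v * mu u.
  move=> uv; have /eqP := mu_polar u v; rewrite uv scale0r addr_eq0 => /eqP ->.
  by apply/eqP; rewrite -subr_eq0 -opprD (addvv_pchar2 char2) oppr0.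
pose u i := mu (plane s i (delta_mx 0 0)).
pose v i := mu (plane s i (delta_mx 0 1)).
have uu i : u i * u i = (a i)%:A.
  by rewrite /u mu2 singular_plane !mxE /= expr0n /= expr1n !mulr0 !addr0 mulr1.
have vv i : v i * v i = (a i * b i)%:A.
  by rewrite /v mu2 singular_plane !mxE /= expr0n /= expr1n mul0r !add0r mulr1.
have uv i : u i * v i + v i * u i = (a i)%:A.
  rewrite /u /v mu_polar singular_polar_plane // eqxx !mxE /=.
  by rewrite mulr1 mulr0 addr0 mulr1.
have planeC i k p p' : i != k ->
    mu (plane s i p) * mu (plane s k p') = mu (plane s k p') * mu (plane s i p).
  by move=> ik; apply: muC; rewrite singular_polar_plane // (negPf ik).
pose J i := (a i)^-1 *: (u i * v i).
have JE i : exists h : {lrmorphism quaternion (b i) (a i) -> C0},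
    h (quat_i (b i) (a i)) = u i /\ h (quat_j (b i) (a i)) = J i.
  have vuE : v i * u i = (a i)%:A - u i * v i by rewrite -uv addrC addKr.
  apply: quaternion_univ => //.
  - have uvuv : u i * v i * (u i * v i) =
        a i *: (u i * v i) - (a i * a i * b i)%:A.
      rewrite -mulrA [v i * _]mulrA vuE mulrBl -[u i * v i * v i]mulrA vv.
      by rewrite mulrBr -scalerAl mul1r -!scalerAr mulr1 uu scalerA mulrAC.
    rewrite /J -scalerAl -scalerAr scalerA uvuv scalerBr !scalerA mulfVK //.
    rewrite addrAC (addvv_pchar2 char2) add0r.
    rewrite [_ * (_ * b i)](_ : _ = b i); last first.
      by rewrite !mulrA mulfVK // mulVf // mul1r.
    by apply/eqP; rewrite eq_sym -subr_eq0 opprK (addvv_pchar2 char2).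
  - rewrite /J -scalerAr -scalerAl -scalerDr -mulrA -mulrDr uv.
    by rewrite -scalerAr mulr1 scalerA mulVf // scale1r.
pose f i : {lrmorphism (quaternion (b i) (a i) : falgType F) -> C0} :=
  projT1 (cid (JE i)).
have fi i : f i (quat_i (b i) (a i)) = u i by case: (projT2 (cid (JE i))).
have fj i : f i (quat_j (b i) (a i)) = J i by case: (projT2 (cid (JE i))).
have f_comm i e : e * u i = u i * e -> e * v i = v i * e ->
    forall x, e * f i x = f i x * e.
  move=> eu ev; apply: quaternion_commute; rewrite ?fi ?fj // /J.
  by rewrite -scalerAr -scalerAl mulrA eu -mulrA ev mulrA.
pose tau j := mu (axis F n (rshift 1 j)).
have t_sqr' j : t j * t j = (c 0 j)%:A by rewrite -t_sqr.
have [||g gE] := multiquadratic_univ t_sqr' t_gen K_dim (tau := tau).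
- by move=> j; rewrite /tau mu2 singular_axis row_mxEr.
- by move=> i j; apply: muC; rewrite singular_polar_axis.
have gC e : (forall j, e * tau j = tau j * e) -> forall y, e * g y = g y * e.
  move=> etau; apply: (multiquadratic_ind t_sqr' t_gen) => [|d x y ex ey|j x ex].
  - by rewrite rmorph1 mulr1 mul1r.
  - by rewrite linearP mulrDr mulrDl -scalerAr -scalerAl ex ey.
  - by rewrite rmorphM /= gE mulrA etau -mulrA ex mulrA.
have [||h [_ hf hg]] := @tensor_seq_univ F 'I_n (fun i => quaternion (b i) (a i))
    K C0 f g (enum 'I_n) _ _ (enum_uniq _).
- move=> i k ik x y; apply: (f_comm).
  + by apply/esym; apply: (f_comm); apply: planeC; rewrite eq_sym.
  + by apply/esym; apply: (f_comm); apply: planeC; rewrite eq_sym.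
- move=> i x y; apply: gC => j; apply/esym; apply: (f_comm); apply/esym.
  + by apply: muC; apply: singular_polar_axis.
  + by apply: muC; apply: singular_polar_axis.
exists h.
have hmu x : exists z, h z = mu x.
  elim/singular_form_ind: x => [d x y [z zE] [z' z'E]||i|i|j].
  - by exists (d *: z + z'); rewrite linearP /= zE z'E /mu linearP.
  - by exists 0; rewrite raddf0 /mu raddf0.
  - have [z zE] := hf i (mem_enum _ i) (quat_i (b i) (a i)).
    by exists z; rewrite zE fi.
  (* v = u * (a^-1 u v), because u^2 = a. *)
  - have [z zE] := hf i (mem_enum _ i) (quat_i (b i) (a i) * quat_j (b i) (a i)).
    exists z; rewrite zE rmorphM /= fi fj /J.
    by rewrite -scalerAr mulrA uu -scalerAl mul1r scalerA mulVf // scale1r.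
  - case: (split_ordP j) => k ->.
      by exists 1; rewrite rmorph1 (ord1 k) /mu even_vec_w.
    by have [z zE] := hg (t k); exists z; rewrite zE gE.
elim/even_clifford_ind => [|d x y [z <-] [z' <-]|x y e [z <-]].
- by exists 1; rewrite rmorph1.
- by exists (d *: z + z'); rewrite linearP.
- have [zx zxE] := hmu x; have [zy zyE] := hmu y.
  by exists (zx * zy * z); rewrite !rmorphM /= zxE zyE -even_pairE.
Qed.

End SingularEven.

Theorem proposition2 (F : fieldType) (char2 : 2%N \in [pchar F])
    (n s : nat) (n_ge1 : (1 <= n)%N) (s_ge1 : (1 <= s)%N)
    (a b : 'I_n -> F) (a_neq0 : forall i, a i != 0) (c : 'rV[F]_s)
    (K : fieldExtType F) (t : 'I_s -> K)
    (t_sqr : forall j, t j ^+ 2 = (c 0 j)%:A)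
    (t_gen : <<1 & [seq t j | j <- enum 'I_s]>>%VS = {:K}%VS)
    (K_dim : \dim {:K} = (2 ^ s)%N) :
  let C0 := even_clifford (singular_form a b c) in
  let T := tensor_seq (quaternions a b) K in
  (exists g : {lrmorphism T -> C0}, bijective g) /\
  (forall g : {lrmorphism T -> C0}, bijective g ->
     has_degree (g \o @tensor_last F (quaternions a b) K) (2 ^ n)).
Proof.
move=> C0 T.
have [cT sT [I [e [eb cardI]]]] := @tensor_seq_csa F K 'I_n
  (fun i => quaternion (b i) (a i)) 4 (enum 'I_n)
  (fun i => quaternion_inner_forms char2 (a_neq0 i))
  (fun i => dim_quaternion (b i) (a i)).
split.
  have [h h_surj] := singular_even_surj b char2 a_neq0 t_sqr t_gen K_dim.
  (* The kernel of h is an ideal of T, and does not contain 1. *)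
  exists h; have h_inj : injective h.
    have [|x y hx hy|x y z hy|h0|h1] := sT (fun x => h x = 0).
    - by rewrite raddf0.
    - by rewrite raddfD /= hx hy addr0.
    - by rewrite !rmorphM /= hy mulr0 mul0r.
    - move=> x y hxy; apply/eqP; rewrite -subr_eq0; apply/eqP/h0.
      by rewrite raddfB /= hxy subrr.
    - by have := h1 1; rewrite rmorph1 => /eqP; rewrite oner_eq0.
  have [h' h'K] := choice h_surj.
  by exists h' => // x; apply: h_inj; rewrite h'K.
move=> g g_bij; apply: has_degree_iso => //.
apply: (has_degreeI cT sT eb).
by rewrite cardI size_enum_ord -expnM mulnC expnM.
Qed.
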